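(* For $n\ge2$, the restriction of the meromorphic function $T(t_1,\ldots,t_n)$ to the hypersurface $t_1\cdots t_n=1$ vanishes identically.
   Context: Fix $q$, $0<|q|<1$. With $(a)_\infty=\prod_{j\ge0}(1-aq^j)$, $\Theta(x)=(q)_\infty^{-2}(x^{1/2}-x^{-1/2})(qx)_\infty(q/x)_\infty$ and $\Theta^{(k)}=(x\frac d{dx})^k\Theta$. Define $$T(t_1,\ldots,t_n)=\sum_{\sigma\in\mathfrak S(n)}\frac{\det\Big(\frac{\Theta^{(j-i+1)}(t_{\sigma(1)}\cdots t_{\sigma(n-j)})}{(j-i+1)!}\Big)_{i,j=1}^n}{\Theta(t_{\sigma(1)})\Theta(t_{\sigma(1)}t_{\sigma(2)})\cdots\Theta(t_{\sigma(1)}\cdots t_{\sigma(n-1)})},$$ where empty products equal $1$, $1/(-k)!:=0$ for $k\ge1$, and square roots of products are products of chosen square roots $t_i^{1/2}$. (Equivalently $T=\Theta(t_1\cdots t_n)\,U(t_1,\ldots,t_n)$ with $U$ the same sum with the extra factor $\Theta(t_{\sigma(1)}\cdots t_{\sigma(n)})$ in the denominator.) *)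

(* Defs.v *)
From HB Require Import structures.
From mathcomp Require Import all_boot all_order all_algebra all_fingroup.
From mathcomp Require Import all_classical all_reals all_analysis.
From mathcomp Require Import complex.
Set Implicit Arguments. Unset Strict Implicit. Unset Printing Implicit Defensive.
Import Order.TTheory GRing.Theory Num.Theory ComplexField.
Import numFieldNormedType.Exports.
Local Open Scope ring_scope.
Local Open Scope complex_scope.

Section Defs.
Variable R : realType.
Notation C := (R[i])^o.

Definition qpoch (q a : C) : C :=
  limn (fun N : nat => \prod_(j < N) (1 - a * q ^+ j)).

(* Theta written in the square-root variable s = x^{1/2}:
   thetas q s = Theta(s^2) with the branch x^{1/2} = s. *)
Definition thetas (q s : C) : C :=
  (qpoch q q)^-2 * (s - s^-1) * qpoch q (q * s ^+ 2) * qpoch q (q / s ^+ 2).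

(* Since x = s^2, the Euler operator x d/dx equals (1/2) s d/ds. *)
Definition euler (f : C -> C) : C -> C := fun s => 2^-1 * s * derive1 f s.

(* thetasD q k s = Theta^{(k)}(s^2), Theta^{(k)} = (x d/dx)^k Theta. *)
Definition thetasD (q : C) (k : nat) : C -> C := iter k euler (thetas q).

(* square root of t_{sigma(1)} ... t_{sigma(k)}, i.e. s_{sigma(1)}...s_{sigma(k)} *)
Definition sprefix (n : nat) (s : 'I_n -> C) (sigma : 'S_n) (k : nat) : C :=
  \prod_(i < n | (i < k)%N) s (sigma i).

(* The matrix in the numerator, with 0-indexed i j : 'I_n; the 1-indexed
   entry (i+1, j+1) is Theta^{(j-i+1)}(t_{sigma(1)}...t_{sigma(n-j-1)})/(j-i+1)!,
   and 0 when j - i + 1 < 0. *)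
Definition Tmat (q : C) (n : nat) (s : 'I_n -> C) (sigma : 'S_n) : 'M[C]_n :=
  \matrix_(i < n, j < n)
    (if (i <= j.+1)%N then
       thetasD q (j.+1 - i) (sprefix s sigma (n - j.+1)) / ((j.+1 - i)`!)%:R
     else 0).

Definition Tden (q : C) (n : nat) (s : 'I_n -> C) (sigma : 'S_n) : C :=
  \prod_(1 <= k < n) thetas q (sprefix s sigma k).

(* T(t_1,...,t_n) with t_i = s_i^2 *)
Definition Tfun (q : C) (n : nat) (s : 'I_n -> C) : C :=
  \sum_(sigma : 'S_n) \det (Tmat q s sigma) / Tden q s sigma.

End Defs.

(* Main.v *)
(* Bloch and Okounkov's [T] is the numerator of a free-fermion correlator. Let
   [U(S)] be the normalised charge-zero correlator of the operators
   [E(t_i) = sum_k t_i^k n_k], i in S, weighted by q^energy. The mode k = 0 has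
   energy 0 and [t^0 = 1], so toggling it changes the sign [(-1)^charge] and
   nothing in [prod_i (E(t_i) - charge + 1/2)]; hence the signed sum of these
   products over all states vanishes. Shifting the modes by the charge turns
   this into
     sum_(B in S) (-1)^|B| Theta^(|B|)(t_(S - B)) U(S - B) = 0,
   where the Laurent coefficients of Theta come from the Jacobi triple product,
   itself the case of empty S of the same bookkeeping. Cramer's rule for the
   Hessenberg determinants shows that the orderings in [T] solve the same
   recursion, so [T = Theta(t_1 ... t_n) U], and [U] stays finite at
   [t_1 ... t_n = 1]. All this converges when every [|t_i| = 1]; the general
   case follows since [T] times a product of thetas is, in each variable
   separately, a limit of Laurent polynomials uniform on annuli, and such a
   function vanishes if it vanishes on the unit circle. *)

Require Import Defs.
From HB Require Import structures.
From mathcomp Require Import all_boot all_order all_algebra all_fingroup.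
From mathcomp Require Import separable cyclotomic cyclic.
From mathcomp Require Import ring lra zify.
Set Implicit Arguments. Unset Strict Implicit. Unset Printing Implicit Defensive.
Import Order.TTheory GRing.Theory Num.Theory.
Local Open Scope ring_scope.

(** * Finite Fock spaces *)

(** The sums run over finite windows of modes, [a] below and [b] above the Fermi level, because
    shifting all modes is then an exact identity that merely moves the window. The half in the
    shifted charge gives the charges [j + 1] and [- j] opposite values of size [(2j + 1) / 2]. These
    are the exponents in Theta, so a [k]-th power of the shifted charge produces the [k]-th Euler
    derivative. The unit circle comes from [eigen]: its modes [t ^ k] extend in both directions, and
    for [|t| = 1] each of them has modulus one, so the weights alone control the sums. On that torus
    the thetas in the denominators may vanish; the function that is continued therefore carries
    enough theta factors to be zero at such points anyway. *)

Fixpoint masks (m : nat) : seq bitseq :=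
  if m is m'.+1 then map (cons false) (masks m') ++ map (cons true) (masks m')
  else [:: [::]].

Lemma size_masks m b : b \in masks m -> size b = m.
Proof.
elim: m b => [|m IH] b /=; first by rewrite inE => /eqP ->.
by rewrite mem_cat => /orP[] /mapP[c /IH <- ->].
Qed.

Lemma sum_masks_cons (V : nmodType) m (f : bitseq -> V) :
  \sum_(b <- masks m.+1) f b =
  \sum_(b <- masks m) (f (false :: b) + f (true :: b)).
Proof. by rewrite /= big_cat !big_map big_split. Qed.

Arguments masks : simpl never.

(** The first bit sits at the Fermi level and the last one at the cutoff: [sum_masks_cons] serves
    shifts and toggles, this form serves enlarging the window. *)
Lemma sum_masks_rcons (V : nmodType) m (f : bitseq -> V) :
  \sum_(b <- masks m.+1) f b =
  \sum_(b <- masks m) (f (rcons b false) + f (rcons b true)).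
Proof.
elim: m f => [|m IH] f; first by rewrite sum_masks_cons !big_seq1.
rewrite [LHS]sum_masks_cons big_split /= [X in X + _]IH [X in _ + X]IH.
rewrite -big_split [RHS]sum_masks_cons.
by apply: eq_bigr => b _ /=; rewrite addrACA.
Qed.

Definition ones (b : bitseq) := count id b.

Fixpoint bitsum (V : nmodType) (f : nat -> V) (b : bitseq) : V :=
  if b is e :: b' then f 0 *+ e + bitsum (f \o succn) b' else 0.

Fixpoint bitprod (F : pzSemiRingType) (f : nat -> F) (b : bitseq) : F :=
  if b is e :: b' then f 0 ^+ e * bitprod (f \o succn) b' else 1.

Lemma eq_bitprod (F : pzSemiRingType) (f g : nat -> F) b :
  f =1 g -> bitprod f b = bitprod g b.
Proof.
elim: b f g => //= e b IH f g fg; rewrite fg; congr (_ * _).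
by apply: IH => j /=; rewrite fg.
Qed.

Lemma bitsum_geom (F : comPzRingType) (c : F) f b :
  (forall j, f j.+1 = c * f j) -> bitsum (f \o succn) b = c * bitsum f b.
Proof.
elim: b f => /= [|e b IH] f fc; first by rewrite mulr0.
by rewrite IH => [|j]; rewrite /= fc // mulrDr mulrnAr.
Qed.

Lemma bitprod_geom (F : comPzRingType) (c : F) f b :
  (forall j, f j.+1 = c * f j) -> bitprod (f \o succn) b = c ^+ ones b * bitprod f b.
Proof.
elim: b f => /= [|e b IH] f fc; first by rewrite mulr1.
by rewrite IH => [|j]; rewrite /= fc // exprD exprMn mulrACA.
Qed.

Lemma bitprodZ (F : comPzRingType) (c : F) f b :
  bitprod (fun j => c * f j) b = c ^+ ones b * bitprod f b.
Proof.
elim: b f => /= [|e b IH] f; first by rewrite mulr1.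
by rewrite (IH (f \o succn)) exprD exprMn mulrACA.
Qed.

Lemma bitprod_rcons (F : comPzRingType) (f : nat -> F) b e :
  bitprod f (rcons b e) = bitprod f b * f (size b) ^+ e.
Proof.
elim: b f => /= [|e' b IH] f; first by rewrite mulr1 mul1r.
by rewrite IH mulrA.
Qed.

Lemma sum_bitprod (F : comPzRingType) (f : nat -> F) m :
  \sum_(b <- masks m) bitprod f b = \prod_(j < m) (1 + f j).
Proof.
elim: m f => [|m IH] f; first by rewrite big_seq1 big_ord0.
rewrite sum_masks_cons big_ord_recl -(IH (f \o succn)) big_distrr.
by apply: eq_bigr => b _ /=; rewrite expr0 expr1 mulrDl.
Qed.

Lemma charge_index x y N : (x <= N.+1)%N -> (y <= N)%N ->
  exists2 j0, (j0 < N.+1)%N &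
  forall j, ((x == j.+1 + y)%N + (y == j + x)%N = (j == j0))%N.
Proof.
move=> xN yN; have [yx|xy] := ltnP y x.
  by exists (x - y).-1 => [|j]; [lia | do 3!case: eqP; lia].
by exists (y - x)%N => [|j]; [lia | do 3!case: eqP; lia].
Qed.

(* Each state has charge [j.+1] or [- j] for a unique [j]. *)
Lemma sum_by_charge (V : nmodType) (f : bitseq -> bitseq -> V) N :
  \sum_(h <- masks N) \sum_(p <- masks N.+1) f h p =
  \sum_(j < N.+1)
   (\sum_(h <- masks N) \sum_(p <- masks N.+1) f h p *+ (ones p == j.+1 + ones h)%N +
    \sum_(h <- masks N) \sum_(p <- masks N.+1) f h p *+ (ones h == j + ones p)%N).
Proof.
under [RHS]eq_bigr => j _ do (rewrite -big_split /=; under eq_bigr => h _ do rewrite -big_split /=).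
rewrite [RHS]exchange_big big_seq [RHS]big_seq; apply: eq_bigr => h /size_masks sh /=.
rewrite [RHS]exchange_big big_seq [RHS]big_seq; apply: eq_bigr => p /size_masks sp /=.
have hp : (ones p <= N.+1)%N by rewrite -sp count_size.
have hh : (ones h <= N)%N by rewrite -sh count_size.
have [j0 j0N charge] := charge_index hp hh.
under eq_bigr => j _ do rewrite -mulrnDr charge.
rewrite (bigD1 (Ordinal j0N)) //= eqxx mulr1n big1 ?addr0 // => j.
by rewrite -val_eqE /= => /negbTE ->.
Qed.

Section Fock.
Context (F : fieldType) (q : F) (q_neq0 : q != 0).

(* A state of the fermionic Fock space occupies a set of modes [k] in Z: [p]
   lists the occupied modes [0, 1, ...] and [h] the empty modes [-1, -2, ...].
   [weight] is [q] to the energy, [eigen t] is the sum of [t ^ k] over the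
   occupied modes with the filled sea regularised to [1 / (t - 1)], and
   [corr] is the correlator over states of charge [0]. *)
Definition weight (h p : bitseq) : F :=
  bitprod (fun j => q ^+ j) p * bitprod (fun j => q ^+ j.+1) h.

Definition eigen (t : F) (h p : bitseq) : F :=
  bitsum (fun j => t ^+ j) p - bitsum (fun j => t ^- j.+1) h + (t - 1)^-1.

(** Modes are independent, so the sum factorises. With [x * y = 1] this becomes the product side of
    the triple product; with [x = y] it sums the majorant in [corr_bounds]. *)
Lemma sum_weight (x y : F) a b :
  \sum_(h <- masks a) \sum_(p <- masks b) x ^+ ones p * y ^+ ones h * weight h p =
  (\prod_(j < b) (1 + x * q ^+ j)) * \prod_(j < a) (1 + y * q ^+ j.+1).
Proof.
rewrite -(sum_bitprod (fun j => x * q ^+ j)) -(sum_bitprod (fun j => y * q ^+ j.+1)).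
rewrite mulrC big_distrl /=.
apply: eq_bigr => h _; rewrite big_distrr /=; apply: eq_bigr => p _.
by rewrite !bitprodZ /weight mulrACA mulrC.
Qed.

(** Move every mode down by one. Mode 0 becomes mode -1, whose bit is complemented because [h]
    records empty modes; the charge drops from [m.+1] to [m] and the energy by [m]. *)
Lemma weight_shift m (h p : bitseq) (e : bool) :
  (e + ones p = m.+1 + ones h)%N ->
  weight h (e :: p) = q ^+ m * weight (~~ e :: h) p.
Proof.
move=> hc; rewrite /weight /= expr0 expr1n mul1r expr1.
rewrite (@bitprod_geom _ q (fun j => q ^+ j)) => [|j]; last exact: exprS.
rewrite (@bitprod_geom _ q (fun j => q ^+ j.+1)) => [|j]; last exact: exprS.
have -> : ones p = (m + (~~ e) + ones h)%N by case: e hc => /=; lia.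
by rewrite !exprD; ring.
Qed.

(** The regularising constant makes this exact: [t / (t - 1) - 1 = 1 / (t - 1)] accounts for the
    mode that crosses the Fermi level. *)
Lemma eigen_shift t (h p : bitseq) (e : bool) : t != 0 -> t != 1 ->
  eigen t h (e :: p) = t * eigen t (~~ e :: h) p.
Proof.
move=> t0 t1; rewrite /eigen /=.
rewrite (@bitsum_geom _ t (fun j => t ^+ j)) => [|j]; last by rewrite exprS.
rewrite (@bitsum_geom _ t^-1 (fun j => t ^- j.+1)) => [|j]; last by rewrite exprS invfM.
rewrite expr0 expr1; have: t - 1 != 0 by rewrite subr_eq0.
by case: e => /= t1'; rewrite ?mulr1n ?mulr0n; field; rewrite t0 t1'.
Qed.

Context {I : finType} (t : I -> F).
Hypotheses (t_neq0 : forall i, t i != 0) (t_neq1 : forall i, t i != 1).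

Definition obs (S : {set I}) (h p : bitseq) : F :=
  weight h p * \prod_(i in S) eigen (t i) h p.

Definition corr (a b : nat) (S : {set I}) : F :=
  \sum_(h <- masks a) \sum_(p <- masks b) obs S h p *+ (ones p == ones h).

Lemma obs_shift S m (h p : bitseq) (e : bool) :
  (e + ones p = m.+1 + ones h)%N ->
  obs S h (e :: p) = q ^+ m * (\prod_(i in S) t i) * obs S (~~ e :: h) p.
Proof.
move=> hc; rewrite /obs (@weight_shift m) // mulrACA -big_split /=.
by congr (_ * _ * _); apply: eq_bigr => i _; rewrite eigen_shift.
Qed.

Lemma sum_shift S m a b :
  \sum_(h <- masks a) \sum_(p <- masks b.+1) obs S h p *+ (ones p == m.+1 + ones h)%N =
  q ^+ m * (\prod_(i in S) t i) *
  \sum_(h <- masks a.+1) \sum_(p <- masks b) obs S h p *+ (ones p == m + ones h)%N.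
Proof.
rewrite [in RHS]sum_masks_cons big_distrr /=; apply: eq_bigr => h _.
rewrite sum_masks_cons mulrDr !big_distrr -big_split /=; apply: eq_bigr => p _.
rewrite addrC; congr (_ + _); rewrite /ones /= -/(ones p) -/(ones h).
  case: (altP (_ =P _)) => hc; last by case: eqP => [|_]; [move/eqP: hc;
    lia | rewrite !mulr0n mulr0].
  by case: eqP => [_|]; [rewrite !mulr1n (@obs_shift _ m) | move/eqP: hc; lia].
case: (altP (_ =P _)) => hc; last by case: eqP => [|_]; [move/eqP: hc; lia | rewrite !mulr0n mulr0].
by case: eqP => [_|]; [rewrite !mulr1n (@obs_shift _ m) | move/eqP: hc; lia].
Qed.

Lemma sum_shiftN S m a b :
  \sum_(h <- masks a.+1) \sum_(p <- masks b) obs S h p *+ (ones h == m.+1 + ones p)%N =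
  q ^+ m.+1 / (\prod_(i in S) t i) *
  \sum_(h <- masks a) \sum_(p <- masks b.+1) obs S h p *+ (ones h == m + ones p)%N.
Proof.
rewrite [in LHS]sum_masks_cons big_distrr /=; apply: eq_bigr => h _.
rewrite -big_split sum_masks_cons big_distrr; apply: eq_bigr => p _ /=; rewrite mulrDr.
have T0 : \prod_(i in S) t i != 0 by apply/prodf_neq0 => i _.
have shift (e : bool) : (ones h + ~~ e = m.+1 + ones p)%N ->
  obs S (~~ e :: h) p = q ^+ m.+1 / (\prod_(i in S) t i) * obs S h (e :: p).
  move=> hc; rewrite /obs.
  have -> : weight h (e :: p) = q ^- m.+1 * weight (~~ e :: h) p.
    rewrite /weight /= expr0 expr1n mul1r expr1.
    rewrite (@bitprod_geom _ q (fun j => q ^+ j)) => [|j]; last exact: exprS.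
    rewrite (@bitprod_geom _ q (fun j => q ^+ j.+1)) => [|j]; last exact: exprS.
    apply: (mulfI (expf_neq0 m.+1 q_neq0)); rewrite mulVKf ?expf_neq0 //.
    have := congr1 (GRing.exp q) hc; rewrite !exprD => hq.
    transitivity (q ^+ m.+1 * q ^+ ones p * (bitprod (fun j => q ^+ j) p *
      bitprod (fun j => q ^+ j.+1) h)); first by ring.
    by rewrite -hq; ring.
  have -> : \prod_(i in S) eigen (t i) h (e :: p) =
     (\prod_(i in S) t i) * \prod_(i in S) eigen (t i) (~~ e :: h) p.
    by rewrite -big_split; apply: eq_bigr => i _; rewrite eigen_shift.
  by field; rewrite T0 expf_neq0.
rewrite addrC; congr (_ + _); rewrite /ones /= -/(ones p) -/(ones h).
  case: (altP (_ =P _)) => hc; last by case: eqP => [|_]; [move/eqP: hc;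
    lia | rewrite !mulr0n mulr0].
  by case: eqP => [_|]; [rewrite !mulr1n (shift false) //= | move/eqP: hc]; lia.
case: (altP (_ =P _)) => hc; last by case: eqP => [|_]; [move/eqP: hc; lia | rewrite !mulr0n mulr0].
by case: eqP => [_|]; [rewrite !mulr1n (shift true) //= | move/eqP: hc]; lia.
Qed.

(** A shift costs an energy equal to the charge it leaves behind, so [m] shifts cost
    [0 + ... + (m - 1)]. In [sum_chargeN] the costs are [1 + ... + m]. *)
Lemma sum_charge S m a b :
  \sum_(h <- masks a) \sum_(p <- masks (b + m)) obs S h p *+ (ones p == m + ones h)%N =
  q ^+ 'C(m, 2) * (\prod_(i in S) t i) ^+ m * corr (a + m) b S.
Proof.
elim: m a => [|m IH] a; first by rewrite !addn0 bin0n expr0 !mul1r.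
rewrite addnS sum_shift IH addSnnS binS bin1 exprD exprS; ring.
Qed.

Lemma sum_chargeN S m a b :
  \sum_(h <- masks (a + m)) \sum_(p <- masks b) obs S h p *+ (ones h == m + ones p)%N =
  q ^+ 'C(m.+1, 2) / (\prod_(i in S) t i) ^+ m * corr a (b + m) S.
Proof.
elim: m b => [|m IH] b.
  rewrite !addn0 expr0 !mul1r invr1 /corr mul1r; apply: eq_bigr => h _.
  by apply: eq_bigr => p _; rewrite eq_sym.
have T0 : \prod_(i in S) t i != 0 by apply/prodf_neq0 => i _.
rewrite addnS sum_shiftN IH addSnnS [in RHS]binS bin1 exprD !exprS invfM; ring.
Qed.

(* Toggling the mode [t^0], which carries energy [0], changes the sign of a
   state but none of the differences [eigen - charge]. *)
Lemma sum_toggle (S : {set I}) (c : F) a b :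
  \sum_(h <- masks a) \sum_(p <- masks b.+1) (-1) ^+ ones p * (-1) ^+ ones h *
    (weight h p * \prod_(i in S) (eigen (t i) h p + ((ones h)%:R - (ones p)%:R + c))) = 0.
Proof.
apply: big1 => h _; rewrite sum_masks_cons; apply: big1 => p _.
rewrite /ones /= -/(ones p) -/(ones h) add0n add1n exprS mulN1r !mulNr.
apply/eqP; rewrite subr_eq0; apply/eqP; rewrite /weight /= !expr0 !expr1n; congr (_ * (_ * _)).
apply: eq_bigr => i _; rewrite /eigen /= !mulr0n !expr0 mulr1n -natr1; ring.
Qed.

End Fock.

(** * Hessenberg determinants and orderings *)

Section Hessenberg.
Context {F : fieldType} (c : nat -> nat -> F).

(** Newest value first: entry [m] is the value at [k - m]. Keeping the whole table turns a
    course-of-values recursion into a structural one. *)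
Fixpoint hess_table (k : nat) : seq F :=
  if k is k'.+1 then
    (\sum_(m < k) (-1) ^+ m * c (k' - m) m.+1 * (hess_table k')`_m) / c k 0
      :: hess_table k'
  else [:: 1].

Definition hess_sol (k : nat) : F := head 0 (hess_table k).

(** The value [hess_sol k] before its division by [c k 0]. It is kept apart because for [k = n] that
    divisor is Theta of the full product, which is zero on the hypersurface. *)
Definition hess_num (k : nat) : F :=
  \sum_(m < k) (-1) ^+ m * c (k.-1 - m) m.+1 * hess_sol (k.-1 - m).

Lemma nth_hess_table k m : (m <= k)%N -> (hess_table k)`_m = hess_sol (k - m).
Proof.
elim: k m => [|k IH] [|m] //= mk.
by rewrite IH.
Qed.

Lemma hess_solS k : hess_sol k.+1 = hess_num k.+1 / c k.+1 0.
Proof.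
rewrite [LHS]/=; congr (_ / _); apply: eq_bigr => m _.
by rewrite nth_hess_table // -ltnS.
Qed.

Definition hess_mx (n : nat) : 'M[F]_n :=
  \matrix_(i < n, j < n) (if (i <= j.+1)%N then c (n - j.+1) (j.+1 - i) else 0).

(* Cramer's rule: [hess_mx] maps the vector [(-1)^j hess_sol (n - j - 1)] to
   [hess_num n] times the first basis vector, and the relevant minor is
   triangular. *)
Lemma det_hess_mx n : (0 < n)%N -> (forall k, (0 < k < n)%N -> c k 0 != 0) ->
  \det (hess_mx n) = hess_num n * \prod_(1 <= k < n) c k 0.
Proof.
case: n => // n _ c0; set M := hess_mx n.+1.
pose w : 'cV[F]_n.+1 := \col_j ((-1) ^+ j * hess_sol (n - j)).
have Mw : M *m w = hess_num n.+1 *: delta_mx 0 0.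
  apply/matrixP => i j; rewrite ord1 !mxE eqxx andbT.
  under eq_bigr => l _ do rewrite !mxE.
  have [->|i0] := eqVneq i 0.
    rewrite mulr1; apply: eq_bigr => l _ /=; rewrite subSS subn0; ring.
  rewrite mulr0; have ik : (0 < i)%N by rewrite lt0n.
  have hk : (0 < n.+1 - i < n.+1)%N by have := ltn_ord i; lia.
  rewrite (bigID (fun l : 'I_n.+1 => (i <= l.+1)%N)) /= addrC big1 ?add0r; last first.
    by move=> l /negbTE ->; rewrite mul0r.
  pose f l := (-1) ^+ l * (c (n - l) (l.+1 - i) * hess_sol (n - l)).
  rewrite (eq_bigr (fun l : 'I_n.+1 => f l)); last first.
    by move=> l ->; rewrite /f subSS mulrCA.
  rewrite -(big_mkord (fun l => (i <= l.+1)%N) f) /=.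
  have i1 : (i.-1 <= n.+1)%N by have := ltn_ord i; lia.
  rewrite (big_cat_nat _ i1) //= big_nat_cond big1 ?add0r; last by move=> l; lia.
  rewrite big_nat_cond (eq_bigl (fun l => (i.-1 <= l < n.+1)%N)); last by move=> l; lia.
  rewrite -big_nat -{1}[i.-1]add0n big_addn.
  have -> : (n.+1 - i.-1 = (n.+1 - i).+1)%N by have := ltn_ord i; lia.
  rewrite big_nat_recl // add0n /f big_mkord.
  have -> : (i.-1.+1 - i = 0)%N by lia.
  have -> : (n - i.-1 = n.+1 - i)%N by lia.
  have : (0 < n.+1 - i)%N by case/andP: hk.
  (* The subdiagonal entry times its unknown is [hess_num], which cancels the rest of the row. *)
  case E : (n.+1 - i)%N hk => [|k] // hk _; rewrite hess_solS [c k.+1 0 * _]mulrC divfK ?c0 //.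
  rewrite /hess_num big_distrr -big_split big1 // => m _ /=.
  have -> : (n - (m.+1 + i.-1) = k - m)%N by lia.
  have -> : ((m.+1 + i.-1).+1 - i = m.+1)%N by lia.
  by rewrite exprD exprS; ring.
have := congr1 (mulmx (\adj M)) Mw; rewrite mulmxA mul_adj_mx mul_scalar_mx.
(* In the last coordinate the vector has entry [(-1) ^+ n], since [hess_sol 0 = 1], and the adjugate
   contributes the cofactor of the top right corner. *)
move/matrixP/(_ ord_max 0); rewrite -scalemxAr !mxE subnn mulr1.
rewrite (bigD1 0) //= big1 => [|l /negbTE l0]; last by rewrite [delta_mx _ _ _ _]mxE l0 mulr0.
rewrite addr0 !mxE eqxx mulr1 /cofactor add0n => e.
suff -> : \prod_(1 <= k < n.+1) c k 0 = \det (row' 0 (col' ord_max M)).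
  by apply: (mulIf (_ : (-1) ^+ n != 0)); rewrite ?signr_eq0 // e /=; ring.
rewrite -det_tr det_trig; last first.
  apply/is_trig_mxP => i j ij; have lt_i (l : 'I_n) : (n <= l)%N = false by rewrite leqNgt ltn_ord.
  rewrite !mxE /= /bump leq0n lt_i /=. by rewrite add0n add1n ltnS leqNgt ij.
rewrite big_add1 /= big_nat_rev /= add0n big_mkord; apply: eq_bigr => i _.
have lt_i (l : 'I_n) : (n <= l)%N = false by rewrite leqNgt ltn_ord.
rewrite !mxE /= /bump leq0n lt_i /= add0n leqnn subnn; congr c; have := ltn_ord i; lia.
Qed.

End Hessenberg.

(** * Orderings of a finite set, as lists *)

Section Orderings.
Context {I : finType}.

Lemma prod_add_const (F : comPzRingType) (f : I -> F) (d : F) (S : {set I}) :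
  \prod_(i in S) (f i + d) =
  \sum_(B : {set I} | B \subset S) d ^+ #|S :\: B| * \prod_(i in B) f i.
Proof.
transitivity (\sum_(B : {set I}) \prod_i
   (if i \in B then (if i \in S then f i else 0) else (if i \in S then d else 1))).
  rewrite -bigA_distr big_mkcond; apply: eq_bigr => i _ /=.
  by case: ifP => _; rewrite ?add0r.
rewrite [RHS]big_mkcond; apply: eq_bigr => B _.
case: ifPn => [/subsetP BS|/subsetPn[i iB iS]]; last first.
  by rewrite (bigD1 i) //= iB (negbTE iS) mul0r.
rewrite (bigID (mem B)) /= mulrC; congr (_ * _).
  rewrite -prodr_const [RHS]big_mkcond [LHS]big_mkcond; apply: eq_bigr => i _.
  by rewrite in_setD; case: ifP => //=; case: ifP.
by apply: eq_bigr => i iB; rewrite iB BS.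
Qed.

Definition orderings (S : {set I}) : seq (seq I) := permutations (enum S).

Lemma mem_orderings S l : (l \in orderings S) = uniq l && ([set x in l] == S).
Proof.
rewrite mem_permutations; apply/idP/andP => [lS|[ul /eqP <-]].
  rewrite (perm_uniq lS) enum_uniq; split=> //.
  by apply/eqP/setP => x; rewrite inE (perm_mem lS) mem_enum.
by apply: uniq_perm; rewrite ?enum_uniq // => x; rewrite mem_enum inE.
Qed.

Lemma size_orderings S l : l \in orderings S -> size l = #|S|.
Proof. by rewrite mem_permutations => /perm_size ->; rewrite -cardE. Qed.

Lemma sum_orderings_const (V : nmodType) (S : {set I}) (x : V) :
  \sum_(l <- orderings S) x = x *+ #|S|`!.
Proof. by rewrite big_const_seq count_predT size_permutations ?enum_uniq // -cardE iter_addr_0. Qed.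

(** Group the orderings by the set [S'] of their first [j] elements; what remains is a free choice
    of an ordering of [S'] and one of its complement. *)
Lemma sum_orderings_cut (V : nmodType) (S : {set I}) j (f : seq I -> V) :
  (j <= #|S|)%N ->
  \sum_(l <- orderings S) f l =
  \sum_(S' : {set I} | (S' \subset S) && (#|S'| == j))
    \sum_(l1 <- orderings S') \sum_(l2 <- orderings (S :\: S')) f (l1 ++ l2).
Proof.
move=> jS; rewrite big_seq.
rewrite (partition_big (fun l => [set x in take j l])
   (fun S' : {set I} => (S' \subset S) && (#|S'| == j))) /=; last first.
  move=> l lS; have sl := size_orderings lS.
  move: lS; rewrite mem_orderings => /andP[ul /eqP <-].
  apply/andP; split; first by apply/subsetP => x; rewrite !inE; exact: mem_take.
  by rewrite cardsE (card_uniqP (take_uniq j ul)) size_takel // sl.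
apply: eq_bigr => S' /andP[S'S /eqP S'j].
rewrite -big_filter -(@big_allpairs_dep _ _ _ _ _ _ (fun l1 l2 => l1 ++ l2)
  _ (fun=> orderings (S :\: S'))).
apply: perm_big; apply: uniq_perm.
- by rewrite filter_uniq // permutations_uniq.
- apply: allpairs_uniq; rewrite ?permutations_uniq // => -[l1 l2] [l1' l2'].
  move=> /allpairsP[[a b] [/= /size_orderings sa _ [-> ->]]].
  move=> /allpairsP[[a' b'] [/= /size_orderings sa' _ [-> ->]]] /= /eqP.
  by rewrite eqseq_cat ?sa ?sa' // => /andP[/eqP -> /eqP ->].
move=> l; rewrite mem_filter /= andbC andbA andbb; apply/andP/allpairsP => /=.
  case=> lS /eqP tS'; exists (take j l, drop j l); rewrite /= cat_take_drop.
  move: lS; rewrite !mem_orderings => /andP[ul /eqP lS]; split=> //.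
    by rewrite take_uniq // tS' eqxx.
  rewrite drop_uniq //=; apply/eqP/setP => x; rewrite -lS -tS' !inE.
  have -> : (x \in l) = (x \in take j l) || (x \in drop j l).
    by rewrite -mem_cat cat_take_drop.
  have := ul; rewrite -{1}(cat_take_drop j l) cat_uniq => /and3P[_ /hasPn nx _].
  by have [xd|_] := boolP (x \in drop j l); rewrite ?(negbTE (nx x xd)) ?orbT //= orbF andNb.
case=> -[l1 l2] /= [l1S' l2S ->]; rewrite take_size_cat ?(size_orderings l1S') //.
move: l1S' l2S; rewrite !mem_orderings cat_uniq => /andP[u1 /eqP s1] /andP[u2 /eqP s2].
split; last by rewrite s1.
rewrite u1 u2 andbT /=; apply/andP; split.
  apply/hasPn => x x2; have : x \in [set y in l2] by rewrite inE.
  by rewrite s2 -s1 !inE => /andP[].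
apply/eqP/setP => x; rewrite inE mem_cat.
have -> : (x \in l1) = (x \in S') by rewrite -s1 inE.
have -> : (x \in l2) = (x \in S :\: S') by rewrite -s2 inE.
by rewrite inE; have [/(subsetP S'S) ->|] := boolP (x \in S').
Qed.

End Orderings.

Lemma perm_orderings n :
  perm_eq [seq [seq (sigma : 'S_n) i | i <- enum 'I_n] | sigma <- index_enum _]
    (orderings [set: 'I_n]).
Proof.
apply: uniq_perm.
- rewrite map_inj_uniq ?index_enum_uniq // => u v uv; apply/permP => i.
  by have := (eq_in_map u v (enum 'I_n)).2 uv i; rewrite mem_enum; apply.
- by rewrite permutations_uniq.
move=> l; rewrite mem_orderings; apply/mapP/andP => [[u _ ->]|[ul /eqP lS]].
  rewrite map_inj_uniq ?enum_uniq //; last exact: perm_inj.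
  split=> //; apply/eqP/setP => x; rewrite !inE; apply/mapP.
  by exists (u^-1 x)%g; rewrite ?mem_enum // permKV.
have sl : size l = n.
  by rewrite -(card_uniqP ul) -[RHS]card_ord -cardsT -lS cardsE.
case: n l ul lS sl => [|n] l ul lS sl.
  by exists 1%g; rewrite ?mem_index_enum //; case: l sl {ul lS} => //; rewrite enum_ord0.
pose g i := nth ord0 l (i : 'I_n.+1).
have g_inj : injective g.
  by move=> i j /eqP; rewrite nth_uniq ?sl ?ltn_ord // => /eqP/val_inj.
exists (perm g_inj); rewrite ?mem_index_enum //.
apply: (@eq_from_nth _ ord0) => [|i it]; first by rewrite size_map size_enum_ord.
rewrite (nth_map ord0) ?size_enum_ord -?sl // permE /g.
by rewrite nth_enum_ord // -sl.
Qed.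

Lemma sum_perm_orderings n (V : nmodType) (f : seq 'I_n -> V) :
  \sum_(sigma : 'S_n) f [seq sigma i | i <- enum 'I_n] =
  \sum_(l <- orderings [set: 'I_n]) f l.
Proof. by rewrite -(perm_big _ (perm_orderings n)) big_map. Qed.

Lemma take_enum_ord n k : take k (enum 'I_n) = [seq i : 'I_n <- enum 'I_n | (i < k)%N].
Proof.
apply: (inj_map val_inj); rewrite map_take val_enum_ord.
rewrite -(filter_map _ (fun i => i < k)%N) val_enum_ord.
have [kn|nk] := leqP k n; first by rewrite take_iota (minn_idPl kn) -(filter_iota_ltn 0 kn).
rewrite take_oversize ?size_iota 1?ltnW //; apply/esym/all_filterP/allP => i.
by rewrite mem_iota add0n => /andP[_ /ltn_trans]; apply.
Qed.

Lemma eq_hess_sol (F : fieldType) (c c' : nat -> nat -> F) k :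
  (forall b, (b <= k)%N -> c b =1 c' b) -> hess_sol c k = hess_sol c' k.
Proof.
elim/ltn_ind: k => -[|k] IH cc' //; rewrite !hess_solS cc' //; congr (_ / _).
apply: eq_bigr => m _ /=; rewrite cc' ?(leq_trans (leq_subr _ _)) //.
by rewrite IH ?ltnS ?leq_subr // => b bk; apply: cc'; rewrite (leq_trans bk)
  // (leq_trans (leq_subr _ _)).
Qed.

(** * Recursion for sums over orderings *)

Section SumOverOrderings.
Context {F : numFieldType} {n : nat} (theta : nat -> F -> F) (s : 'I_n -> F).

Definition set_prod (S : {set 'I_n}) : F := \prod_(i in S) s i.

Definition list_coef (l : seq 'I_n) (b m : nat) : F :=
  theta m (\prod_(i <- take b l) s i) / m`!%:R.

(** This is [U(S)]: by [det_hess_mx], [hess_sol] is the determinant divided by all the prefix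
    thetas, including that of the full product. *)
Definition ordered_sum (S : {set 'I_n}) : F :=
  \sum_(l <- orderings S) hess_sol (list_coef l) #|S|.

Lemma prod_ordering S l : l \in orderings S -> \prod_(i <- l) s i = set_prod S.
Proof.
by rewrite mem_permutations => lS; rewrite (perm_big _ lS) big_enum.
Qed.

Lemma list_coef_cat l1 l2 b : (b <= size l1)%N -> list_coef (l1 ++ l2) b =1 list_coef l1 b.
Proof.
by move=> bl m; rewrite /list_coef takel_cat.
Qed.

(** The summand [m] of [hess_num] sees only the prefix that omits the last [m.+1] elements. The
    [m.+1] factorial orderings of those elements give equal terms and cancel the factorial in the
    matrix entry. *)
Lemma sum_hess_num S : S != set0 ->
  \sum_(l <- orderings S) hess_num (list_coef l) #|S| =
  \sum_(S' : {set 'I_n} | S' \proper S)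
    (-1) ^+ #|S :\: S'|.-1 * theta #|S :\: S'| (set_prod S') * ordered_sum S'.
Proof.
rewrite -card_gt0; case SK: #|S| => [|K] // _; rewrite exchange_big /=.
rewrite (partition_big (fun S' : {set 'I_n} => inord (K - #|S'|) : 'I_K.+1) predT) //=.
apply: eq_bigr => m _; have mK : (m <= K)%N by rewrite -ltnS.
rewrite (@sum_orderings_cut _ _ _ (K - m)) //; last by rewrite SK leqW // leq_subr.
apply: eq_big => [S'|S' /andP[S'S /eqP S'j]].
  rewrite properEcard SK ltnS -andbA; congr (_ && _); apply/eqP/andP => [->|[S'K /eqP <-]].
    by rewrite leq_subr subKn // inord_val.
  by rewrite inordK ?ltnS ?leq_subr // subKn.
have cD : #|S :\: S'| = m.+1 by rewrite cardsD (setIidPr S'S) S'j SK; lia.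
rewrite cD /= /ordered_sum big_distrr /= big_seq [RHS]big_seq; apply: eq_bigr => l1 l1S'.
rewrite (eq_bigr (fun=> (-1) ^+ m * (theta m.+1 (set_prod S') / m.+1`!%:R) *
    hess_sol (list_coef l1) #|S'|)).
  rewrite sum_orderings_const cD -mulr_natr; field.
  by rewrite pnatr_eq0 -lt0n fact_gt0.
move=> l2 _; have sl1 := size_orderings l1S'.
rewrite -S'j list_coef_cat ?sl1 // [list_coef _ _ _]/list_coef take_oversize ?sl1 //.
rewrite (prod_ordering l1S'); congr (_ * _).
by apply: eq_hess_sol => b bl; apply: list_coef_cat; rewrite sl1.
Qed.

Lemma set_prod_list_coef S l : l \in orderings S ->
  list_coef l #|S| 0 = theta 0 (set_prod S).
Proof.
move=> lS; rewrite /list_coef take_oversize ?(size_orderings lS) //.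
by rewrite (prod_ordering lS) fact0 divr1.
Qed.

Lemma theta_ordered_sum S : S != set0 -> theta 0 (set_prod S) != 0 ->
  theta 0 (set_prod S) * ordered_sum S =
  \sum_(l <- orderings S) hess_num (list_coef l) #|S|.
Proof.
move=> S0 th0; rewrite /ordered_sum big_distrr /= big_seq [RHS]big_seq.
apply: eq_bigr => l lS; move: S0; rewrite -card_gt0.
case SK: #|S| => [|K] // _; rewrite hess_solS -SK set_prod_list_coef // mulrC divfK //.
Qed.

Context (y : {set 'I_n} -> F).
Hypothesis relation : forall S : {set 'I_n},
  \sum_(S' : {set 'I_n} | S' \subset S)
     (-1) ^+ #|S :\: S'| * theta #|S :\: S'| (set_prod S') * y S' = 0.
Hypothesis theta_neq0 : forall S : {set 'I_n},
  S != set0 -> S != [set: 'I_n] -> theta 0 (set_prod S) != 0.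

Lemma relation_proper S :
  theta 0 (set_prod S) * y S =
  \sum_(S' : {set 'I_n} | S' \proper S)
    (-1) ^+ #|S :\: S'|.-1 * theta #|S :\: S'| (set_prod S') * y S'.
Proof.
have := relation S; rewrite (bigD1 S) //= setDv cards0 mul1r => /eqP.
rewrite addr_eq0 => /eqP ->; rewrite -sumrN; apply: eq_big => [S'|S' S'S].
  by rewrite properEneq andbC.
have : (0 < #|S :\: S'|)%N.
  rewrite card_gt0 setD_eq0; move: S'S => /andP[S'S S'n].
  by apply: contra S'n => SS'; rewrite eqEsubset S'S.
by case: #|S :\: S'| => // k _; rewrite exprS; ring.
Qed.

(** Both sides obey the same recursion over proper subsets, which determines them as long as Theta
    of the product over [S] can be divided out; this fails only for the full set. *)
Lemma ordered_sum_relation S : S != [set: 'I_n] -> y S = y set0 * ordered_sum S.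
Proof.
have [k] := ubnP #|S|; elim: k S => // k IH S Sk ST.
have [->|S0] := eqVneq S set0.
  rewrite /ordered_sum /orderings enum_set0 cards0 /= big_seq1.
  by rewrite /hess_sol /= mulr1.
have th0 := theta_neq0 S0 ST; apply: (mulfI th0).
rewrite relation_proper mulrCA theta_ordered_sum // sum_hess_num // big_distrr /=.
apply: eq_bigr => S' S'S; rewrite IH; first by ring.
  by apply: leq_trans (proper_card S'S) _.
by apply: contraTneq S'S => ->; rewrite properE subsetT andbF.
Qed.

(** In the relation for the full set the term with [y [set: 'I_n]] is a finite value times a
    vanishing theta. The remaining terms, which are [y set0] times the claimed sum, must therefore
    vanish. *)
Lemma sum_hess_num_eq0 : (0 < n)%N -> y set0 != 0 ->
  theta 0 (set_prod [set: 'I_n]) = 0 ->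
  \sum_(l <- orderings [set: 'I_n]) hess_num (list_coef l) n = 0.
Proof.
move=> n0 y0 thT; apply: (mulfI y0); rewrite mulr0.
have cT : #|[set: 'I_n]| = n by rewrite cardsT card_ord.
have := @sum_hess_num [set: 'I_n]; rewrite cT => ->; last by rewrite -card_gt0 cT.
have e := relation_proper [set: 'I_n]; rewrite thT mul0r in e; rewrite [RHS]e big_distrr /=.
apply: eq_bigr => S' S'T; rewrite [in RHS]ordered_sum_relation; first by ring.
by apply: contraTneq S'T => ->; rewrite properxx.
Qed.

End SumOverOrderings.

Section DeterminantSum.
Context {F : numFieldType} {n : nat} (theta : nat -> F -> F) (s : 'I_n -> F).

Definition perm_prefix (sigma : 'S_n) (k : nat) : F :=
  \prod_(i < n | (i < k)%N) s (sigma i).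

Definition prefix_mx (sigma : 'S_n) : 'M[F]_n :=
  \matrix_(i < n, j < n)
    (if (i <= j.+1)%N then
       theta (j.+1 - i) (perm_prefix sigma (n - j.+1)) / ((j.+1 - i)`!)%:R
     else 0).

Definition prefix_den (sigma : 'S_n) : F := \prod_(1 <= k < n) theta 0 (perm_prefix sigma k).

Lemma perm_prefixE sigma k :
  perm_prefix sigma k = \prod_(i <- take k [seq sigma i | i <- enum 'I_n]) s i.
Proof. by rewrite -map_take big_map take_enum_ord big_filter big_enum_cond. Qed.

Lemma sum_det_prefix_mx (y : {set 'I_n} -> F) : (0 < n)%N ->
  (forall S : {set 'I_n}, \sum_(S' : {set 'I_n} | S' \subset S)
     (-1) ^+ #|S :\: S'| * theta #|S :\: S'| (set_prod s S') * y S' = 0) ->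
  (forall sigma k, (0 < k < n)%N -> theta 0 (perm_prefix sigma k) != 0) ->
  y set0 != 0 -> theta 0 (\prod_i s i) = 0 ->
  \sum_(sigma : 'S_n) \det (prefix_mx sigma) / prefix_den sigma = 0.
Proof.
move=> n0 rel th0 y0 thT; rewrite -[RHS](@sum_hess_num_eq0 _ _ theta s y) //.
- rewrite -sum_perm_orderings; apply: eq_bigr => sigma _.
  set l := [seq _ | _ <- _].
  have c0 k : list_coef theta s l k 0 = theta 0 (perm_prefix sigma k).
    by rewrite /list_coef fact0 divr1 perm_prefixE.
  have -> : prefix_mx sigma = hess_mx (list_coef theta s l) n.
    by apply/matrixP => i j; rewrite !mxE /list_coef perm_prefixE.
  rewrite det_hess_mx // => [|k kn]; last by rewrite c0 th0.
  rewrite /prefix_den; under [X in _ / X]eq_bigr => k _ do rewrite -c0.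
  rewrite mulfK // big_nat prodf_seq_neq0; apply/allP => k _; apply/implyP => kn.
  by rewrite c0 th0.
(* Every proper nonempty subset is a prefix of some ordering, so the hypothesis on prefixes covers
   it. *)
- move=> S S0 ST; have : enum S ++ enum (~: S) \in orderings [set: 'I_n].
    rewrite mem_orderings cat_uniq !enum_uniq /= andbT; apply/andP; split.
      by apply/hasPn => x; rewrite !mem_enum inE.
    by apply/eqP/setP => x; rewrite !inE mem_cat !mem_enum inE orbN.
  rewrite -(perm_mem (perm_orderings n)) => /mapP[sigma _ lE].
  have := th0 sigma #|S|; rewrite perm_prefixE -lE take_size_cat -?cardE // big_enum.
  by apply; rewrite card_gt0 S0 -[ltnRHS]card_ord -cardsT proper_card // properT.
by rewrite -[RHS]thT; congr (theta 0 _); apply: eq_bigl => i; rewrite inE.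
Qed.

End DeterminantSum.

(* Imported only now because classical_sets shadows the names of finset. *)
From mathcomp Require Import all_classical all_reals all_analysis.
From mathcomp Require Import complex.
Import Order.TTheory GRing.Theory Num.Theory ComplexField.
Import numFieldNormedType.Exports.
Local Open Scope ring_scope.
Local Open Scope complex_scope.

(** * Convergence of complex sequences *)

(** The norm of [R[i]] has values in [R[i]]; a modulus in [R] gives access to total order and real
    series. *)
Definition cabs {R : realType} (z : R[i]) : R := Normc.normc z.
Arguments cabs {R} z : simpl never.

Section ComplexAnalysis.
Context {R : realType}.
Local Notation C := R[i].
Implicit Types x y z : C.

Lemma normr_cabs (z : C) : `|z| = (cabs z)%:C. Proof. by []. Qed.
Lemma cabs0 : cabs 0 = 0 :> R. Proof. exact: Normc.normc0. Qed.
Lemma cabs1 : cabs 1 = 1 :> R. Proof. exact: Normc.normc1. Qed.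
Lemma cabsM x y : cabs (x * y) = cabs x * cabs y. Proof. exact: Normc.normcM. Qed.
Lemma cabsV x : cabs x^-1 = (cabs x)^-1. Proof. exact: Normc.normcV. Qed.
Lemma cabsD x y : cabs (x + y) <= cabs x + cabs y. Proof. exact: le_normcD. Qed.
Lemma cabsN x : cabs (- x) = cabs x. Proof. exact: normcN. Qed.
Lemma cabs_ge0 x : 0 <= cabs x. Proof. by case: x => a b; exact: sqrtr_ge0. Qed.
Lemma cabs_eq0 x : (cabs x == 0) = (x == 0).
Proof.
by apply/eqP/eqP => [/Normc.eq0_normc //|->]; exact: cabs0.
Qed.
Lemma cabs_gt0 x : (0 < cabs x) = (x != 0).
Proof. by rewrite lt_def cabs_ge0 andbT cabs_eq0. Qed.

Lemma cabsX x n : cabs (x ^+ n) = cabs x ^+ n.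
Proof. by elim: n => [|n IH]; rewrite ?cabs1 // !exprS cabsM IH. Qed.

Lemma cabs_real (x : R) : 0 <= x -> cabs (x%:C : C) = x.
Proof. by move=> x0; rewrite /cabs /= expr0n /= addr0 sqrtr_sqr ger0_norm. Qed.

Lemma cabs_nat n : cabs (n%:R : C) = n%:R.
Proof. by rewrite -[n%:R](rmorph_nat (real_complex R)) cabs_real. Qed.

Lemma cabsB x y : cabs (x - y) <= cabs x + cabs y.
Proof. by rewrite -(cabsN y); exact: cabsD. Qed.

Lemma cabs_distC x y : cabs (x - y) = cabs (y - x).
Proof. by rewrite -cabsN opprB. Qed.

Lemma cabs_sum I (s : seq I) (P : pred I) (f : I -> C) :
  cabs (\sum_(i <- s | P i) f i) <= \sum_(i <- s | P i) cabs (f i).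
Proof.
elim/big_rec2: _ => [|i a b _ ab]; first by rewrite cabs0.
by apply: le_trans (cabsD _ _) _; rewrite lerD2l.
Qed.

Lemma cabs_prod I (s : seq I) (P : pred I) (f : I -> C) :
  cabs (\prod_(i <- s | P i) f i) = \prod_(i <- s | P i) cabs (f i).
Proof. by elim/big_rec2: _ => [|i a b _ <-]; rewrite ?cabs1 ?cabsM. Qed.

Lemma cabs_Re (z : C) : `|complex.Re z| <= cabs z.
Proof.
case: z => a b; rewrite /cabs /= -(ger0_norm (sqrtr_ge0 _)) -ler_sqr ?nnegrE //.
by rewrite !real_normK ?num_real // sqr_sqrtr ?addr_ge0 ?sqr_ge0 // lerDl sqr_ge0.
Qed.

Lemma cabs_Im (z : C) : `|complex.Im z| <= cabs z.
Proof.
case: z => a b; rewrite /cabs /= -(ger0_norm (sqrtr_ge0 _)) -ler_sqr ?nnegrE //.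
by rewrite !real_normK ?num_real // sqr_sqrtr ?addr_ge0 ?sqr_ge0 // lerDr sqr_ge0.
Qed.

Lemma cabs_le_ReIm (z : C) : cabs z <= `|complex.Re z| + `|complex.Im z|.
Proof.
case: z => a b; rewrite /cabs /= -ler_sqr ?nnegrE ?sqrtr_ge0 ?addr_ge0 //.
rewrite sqr_sqrtr ?addr_ge0 ?sqr_ge0 // sqrrD !real_normK ?num_real //.
by rewrite addrAC lerDl mulrn_wge0 // mulr_ge0.
Qed.

Definition cvgC (u : nat -> C) (l : C) : Prop :=
  forall e : R, 0 < e -> exists N, forall n, (N <= n)%N -> cabs (u n - l) < e.

Lemma cvgCP (u : nat -> C) (l : C) :
  cvgC u l <-> ((u : nat -> C^o) @ \oo --> (l : C^o))%classic.
Proof.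
split=> [ul|ul e e0].
  apply/cvgrPdist_lt => e e0.
  have eR : e = (complex.Re e)%:C by case: e e0 => a b; rewrite ltcE /= => /andP[/eqP ->].
  have [|N uN] := ul (complex.Re e); first by move: e0; rewrite ltcE => /andP[].
  by exists N => // n /= /uN; rewrite eR normr_cabs ltcR cabs_distC.
have e0' : 0 < e%:C by rewrite ltcR.
have /cvgrPdist_lt/(_ _ e0')[N _ uN] := ul.
by exists N => n /uN; rewrite /= normr_cabs ltcR cabs_distC.
Qed.

Lemma cvgC_lim (u : nat -> C) (l : C) : cvgC u l -> limn (u : nat -> C^o) = l.
Proof. by move/cvgCP/cvg_lim; apply. Qed.

Lemma cvgC_uniq (u : nat -> C) (l l' : C) : cvgC u l -> cvgC u l' -> l = l'.
Proof. by move=> /cvgC_lim <- /cvgC_lim. Qed.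

Lemma cvgC_cst (l : C) : cvgC (fun=> l) l.
Proof. by move=> e e0; exists 0 => n _; rewrite subrr cabs0. Qed.

Lemma cvgCD u v (l m : C) : cvgC u l -> cvgC v m -> cvgC (fun n => u n + v n) (l + m).
Proof. by move=> /cvgCP ul /cvgCP vm; apply/cvgCP; exact: (cvgD ul vm). Qed.

Lemma cvgCM u v (l m : C) : cvgC u l -> cvgC v m -> cvgC (fun n => u n * v n) (l * m).
Proof. by move=> /cvgCP ul /cvgCP vm; apply/cvgCP; exact: (cvgM ul vm). Qed.

Lemma cvgCZ c u (l : C) : cvgC u l -> cvgC (fun n => c * u n) (c * l).
Proof. by apply: cvgCM; exact: cvgC_cst. Qed.

Lemma cvgCN u (l : C) : cvgC u l -> cvgC (fun n => - u n) (- l).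
Proof. by move=> /cvgCP ul; apply/cvgCP; exact: (cvgN ul). Qed.

Lemma cvgCB u v (l m : C) : cvgC u l -> cvgC v m -> cvgC (fun n => u n - v n) (l - m).
Proof. by move=> ul /cvgCN; exact: cvgCD. Qed.

Lemma cvgC_sum I (s : seq I) (P : pred I) (u : I -> nat -> C) (l : I -> C) :
  (forall i, P i -> cvgC (u i) (l i)) ->
  cvgC (fun n => \sum_(i <- s | P i) u i n) (\sum_(i <- s | P i) l i).
Proof.
move=> ul; elim: s => [|i s IH].
  by under eq_fun => n do rewrite big_nil; rewrite big_nil; exact: cvgC_cst.
under eq_fun => n do rewrite big_cons; rewrite big_cons.
by case: ifP => // /ul uli; exact: cvgCD.
Qed.

Lemma cvgC_shift k (u : nat -> C) (l : C) : cvgC u l -> cvgC (fun n => u (n + k)%N) l.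
Proof.
by move=> ul e /ul[N uN]; exists N => n Nn; apply: uN; rewrite (leq_trans Nn) ?leq_addr.
Qed.

Lemma cvgC_unshift k (u : nat -> C) (l : C) : cvgC (fun n => u (n + k)%N) l -> cvgC u l.
Proof.
move=> ul e /ul[N uN]; exists (N + k)%N => n Nn.
have kn : (k <= n)%N by lia.
by rewrite -(subnK kn); apply: uN; lia.
Qed.

Lemma cvgC_le (u : nat -> C) (l : C) (B : R) :
  cvgC u l -> (forall n, cabs (u n) <= B) -> cabs l <= B.
Proof.
move=> ul uB; rewrite leNgt; apply/negP => Bl.
have [|N /(_ N (leqnn N)) uN] := ul (cabs l - B); first by rewrite subr_gt0.
have := cabsB (u N) (u N - l); rewrite subKr => h.
by have := uB N; lra.
Qed.

Lemma geometric_small (K r e : R) : 0 <= r < 1 -> 0 < e ->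
  exists N, forall n, (N <= n)%N -> K * r ^+ n < e.
Proof.
move=> /andP[r0 r1] e0.
have : ((fun n => K * r ^+ n) @ \oo --> (0 : R))%classic.
  by apply: cvg_geometric; rewrite ger0_norm.
move=> /cvgrPdist_lt/(_ _ e0)[N _ h]; exists N => n /h /=; rewrite sub0r normrN.
exact: le_lt_trans (ler_norm _).
Qed.

Lemma geometric_sum_le (r : R) m n : 0 <= r < 1 ->
  \sum_(m <= j < n) r ^+ j <= r ^+ m / (1 - r).
Proof.
move=> /andP[r0 r1]; rewrite ler_pdivlMr ?subr_gt0 //.
have [nm|mn] := leqP n m; first by rewrite big_geq // mul0r exprn_ge0.
suff -> : (\sum_(m <= j < n) r ^+ j) * (1 - r) = r ^+ m - r ^+ n.
  by rewrite gerBl exprn_ge0.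
rewrite -[RHS]opprB -(telescope_sumr _ (ltnW mn)) -sumrN big_distrl /=.
by apply: eq_bigr => j _; rewrite exprS; ring.
Qed.

Lemma cvg_geometric_cauchyR (u : nat -> R) (K r : R) : 0 <= r < 1 ->
  (forall n, `|u n.+1 - u n| <= K * r ^+ n) -> cvgn u.
Proof.
move=> r01 uK; have -> : u = (fun n => u 0 + series (telescope u) n).
  by apply/funext => n; rewrite -eq_sum_telescope.
apply: is_cvgD; first exact: is_cvg_cst.
apply: normed_cvg; apply: (@series_le_cvg _ _ (fun n => K * r ^+ n)).
- by move=> n; exact: normr_ge0.
- by move=> n; exact: le_trans (uK n).
- exact: uK.
by apply: is_cvg_geometric_series; case/andP: r01 => r0 r1; rewrite ger0_norm.
Qed.

Lemma cvgC_geometric u (l : C) (K r : R) : 0 <= r < 1 ->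
  (forall n, cabs (u n - l) <= K * r ^+ n) -> cvgC u l.
Proof.
move=> r01 uK e e0; have [N hN] := geometric_small K r01 e0.
by exists N => n /hN; apply: le_lt_trans.
Qed.

(** The rate depends on [K] and [r] alone, so a bound uniform in a parameter yields uniform
    convergence, as [theta_half_approx] requires. *)
Lemma cvgC_geometric_cauchy (u : nat -> C) (K r : R) : 0 <= r < 1 ->
  (forall n, cabs (u n.+1 - u n) <= K * r ^+ n) ->
  exists l, cvgC u l /\ forall n, cabs (u n - l) <= K / (1 - r) * r ^+ n.
Proof.
move=> r01 uK.
have cvRe : cvgn (fun n => complex.Re (u n)).
  apply: (@cvg_geometric_cauchyR _ K r) => // n; apply: le_trans (uK n).
  by rewrite -raddfB; exact: cabs_Re.
have cvIm : cvgn (fun n => complex.Im (u n)).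
  apply: (@cvg_geometric_cauchyR _ K r) => // n; apply: le_trans (uK n).
  by rewrite -raddfB; exact: cabs_Im.
set a := limn (fun n => complex.Re (u n)) in cvRe; set b := limn (fun n => complex.Im (u n))
  in cvIm.
have ul : cvgC u (a +i* b).
  move=> e e0; have e20 : 0 < e / 2 by rewrite divr_gt0.
  have /cvgrPdist_lt/(_ _ e20)[N1 _ h1] := cvRe.
  have /cvgrPdist_lt/(_ _ e20)[N2 _ h2] := cvIm.
  exists (maxn N1 N2) => n; rewrite geq_max => /andP[n1 n2].
  apply: le_lt_trans (cabs_le_ReIm _) _; rewrite !raddfB /=.
  have /= := h1 n n1; have /= := h2 n n2; rewrite -/a -/b distrC [X in _ -> X < _ -> _]distrC.
  by lra.
exists (a +i* b); split=> // n.
have K0 : 0 <= K by have := uK 0; rewrite expr0 mulr1; apply: le_trans; exact: cabs_ge0.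
apply: (@cvgC_le (fun m => u n - u (m + n)%N)).
  by apply: cvgCB; [exact: cvgC_cst | exact: cvgC_shift].
move=> m; apply: (@le_trans _ _ (K * \sum_(n <= j < m + n) r ^+ j)); last first.
  by rewrite mulrAC -mulrA ler_wpM2l // geometric_sum_le.
rewrite cabs_distC -telescope_sumr ?leq_addl // big_distrr /=.
by apply: le_trans (cabs_sum _ _ _) _; apply: ler_sum.
Qed.

End ComplexAnalysis.

(** * Limits of the correlators *)

Section CorrBounds.
Context {R : realType}.
Local Notation C := R[i].

Lemma prod_geometric_bounded (r A : R) : 0 <= r < 1 -> 0 <= A ->
  exists2 P, 1 <= P & forall N, \prod_(j < N) (1 + A * r ^+ j) <= P.
Proof.
move=> r01 A0; have [r0 r1] := andP r01; exists (expR (A / (1 - r))).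
  by rewrite -[leLHS]expR0 ler_expR divr_ge0 // subr_ge0 ltW.
move=> N; apply: (@le_trans _ _ (\prod_(j < N) expR (A * r ^+ j))).
  by apply: ler_prod => j _; rewrite expR_ge1Dx andbT addr_ge0 // mulr_ge0 // exprn_ge0.
rewrite -expR_sum ler_expR -big_distrr /= ler_wpM2l //.
by rewrite -(big_mkord predT (fun j => r ^+ j)) (le_trans (geometric_sum_le _ _ r01))
  // expr0 mul1r.
Qed.

Lemma cabs_bitprod (f : nat -> C) b : cabs (bitprod f b) = bitprod (fun j => cabs (f j)) b.
Proof.
elim: b f => /= [|e b IH] f; first exact: cabs1.
by rewrite cabsM IH cabsX.
Qed.

Lemma bitprod_ge0 (f : nat -> R) b : (forall j, 0 <= f j) -> 0 <= bitprod f b.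
Proof.
elim: b f => //= e b IH f f0.
by apply: mulr_ge0; [exact: exprn_ge0 | apply: IH => j; exact: f0].
Qed.

Lemma cabs_weight (q : C) h p : cabs (weight q h p) = weight (cabs q) h p.
Proof.
rewrite cabsM !cabs_bitprod /weight.
by congr (_ * _); apply: eq_bitprod => j; rewrite cabsX.
Qed.

Lemma weight_ge0 (r : R) h p : 0 <= r -> 0 <= weight r h p.
Proof. by move=> r0; rewrite mulr_ge0 // bitprod_ge0 // => j; rewrite exprn_ge0. Qed.

Lemma cabs_bitsum (f : nat -> C) b : (forall j, cabs (f j) <= 1) ->
  cabs (bitsum f b) <= (ones b)%:R.
Proof.
elim: b f => /= [|e b IH] f f1; first by rewrite cabs0.
rewrite natrD; apply: le_trans (cabsD _ _) _; apply: lerD; last by apply: IH => j /=.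
by case: e; rewrite ?mulr0n ?cabs0 ?mulr1n.
Qed.

(** The natural bound is linear in the number of bits set. It is weakened to a power of 2 so that it
    becomes multiplicative over modes and can be merged with the weight. *)
Lemma cabs_eigen (t : C) (K : R) h p : cabs t = 1 -> 1 + cabs (t - 1)^-1 <= K ->
  cabs (eigen t h p) <= K * 2 ^+ (ones p + ones h).
Proof.
move=> t1 tK.
have hp : cabs (bitsum (fun j => t ^+ j) p) <= (ones p)%:R.
  by apply: cabs_bitsum => j; rewrite cabsX t1 expr1n.
have hh : cabs (bitsum (fun j => t ^- j.+1) h) <= (ones h)%:R.
  by apply: cabs_bitsum => j; rewrite cabsV cabsX t1 expr1n invr1.
have n2 : (ones p)%:R + (ones h)%:R + 1 <= 2 ^+ (ones p + ones h) :> R.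
  by rewrite -natrD natr1 -natrX ler_nat ltn_expl.
have c0 := cabs_ge0 (t - 1)^-1.
have := cabsD (bitsum (fun j => t ^+ j) p - bitsum (fun j => t ^- j.+1) h) (t - 1)^-1.
have := cabsB (bitsum (fun j => t ^+ j) p) (bitsum (fun j => t ^- j.+1) h).
rewrite -/(eigen t h p).
move: (2 ^+ _) n2 => X X1; have p0 : 0 <= (ones p)%:R :> R by [];
  have h0 : 0 <= (ones h)%:R :> R by [].
move=> h1 h2.
have : (1 + cabs (t - 1)^-1) * X <= K * X by apply: ler_wpM2r => //; lra.
nra.
Qed.

Lemma eigen_rcons_false (F : fieldType) (t : F) h p :
  (eigen t h (rcons p false) = eigen t h p) * (eigen t (rcons h false) p = eigen t h p).
Proof.
have rc f b : bitsum f (rcons b false) = bitsum f b :> F.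
  by elim: b f => /= [|e b IH] f; rewrite ?IH // mulr0n addr0.
by split; rewrite /eigen rc.
Qed.

Context (q : C) (q_lt1 : cabs q < 1).
Context {I : finType} (t : I -> C).
Hypothesis t_unit : forall i, cabs (t i) = 1.

Let r := cabs q.
Let r01 : 0 <= r < 1. Proof. by rewrite cabs_ge0 q_lt1. Qed.

(** The majorant [B] is multiplicative over modes, so its total is bounded by convergent products.
    Enlarging the window adds only states with the new bit set, and that bit costs a factor [A]
    times a power of [r] given by the cutoff. *)
Lemma corr_bounds (S : {set I}) : exists2 M : R, 0 <= M &
  forall a b, [/\ cabs (corr q t a b S) <= M,
    cabs (corr q t a b.+1 S - corr q t a b S) <= M * r ^+ b &
    cabs (corr q t a.+1 b S - corr q t a b S) <= M * r ^+ a].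
Proof.
pose K := \sum_i (1 + cabs (t i - 1)^-1).
have tK i : 1 + cabs (t i - 1)^-1 <= K.
  rewrite /K (bigD1 i) //= lerDl sumr_ge0 // => j _.
  by rewrite addr_ge0 // cabs_ge0.
pose A : R := 2 ^+ #|S|.
have A1 : 1 <= A by rewrite exprn_ege1 // ler1n.
have A0 : 0 <= A := le_trans ler01 A1.
pose B h p : R := K ^+ #|S| * (A ^+ ones p * A ^+ ones h * weight r h p).
have r0 : 0 <= r by case/andP: r01.
have r1 : r <= 1 by case/andP: r01 => _ /ltW.
have obsB h p : cabs (obs q t S h p) <= B h p.
  rewrite cabsM cabs_weight cabs_prod /B mulrC -/r mulrA.
  apply: ler_wpM2r; first exact: weight_ge0.
  have -> : K ^+ #|S| * (A ^+ ones p * A ^+ ones h) = \prod_(i in S) (K * 2 ^+ (ones p + ones h)).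
    by rewrite prodr_const exprMn -exprD -!exprM [(#|S| * _)%N]mulnC.
  by apply: ler_prod => i _; rewrite cabs_ge0 cabs_eigen.
have K0 : 0 <= K by apply: sumr_ge0 => i _; rewrite addr_ge0 // cabs_ge0.
have B0 h p : 0 <= B h p.
  exact: mulr_ge0 (exprn_ge0 _ K0) (mulr_ge0 (mulr_ge0 (exprn_ge0 _ A0) (exprn_ge0 _ A0))
    (weight_ge0 h p r0)).
have [P P1 hP] := prod_geometric_bounded r01 A0.
have P0 : 0 <= P := le_trans ler01 P1.
pose M := K ^+ #|S| * (P * P).
have M0 : 0 <= M by exact: mulr_ge0 (exprn_ge0 _ K0) (mulr_ge0 P0 P0).
have sumB a b : \sum_(h <- masks a) \sum_(p <- masks b) B h p <= M.
  under eq_bigr => h _ do rewrite -big_distrr /=.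
  rewrite -big_distrr /= sum_weight ler_wpM2l ?exprn_ge0 //.
  have f0 j : 0 <= 1 + A * r ^+ j by rewrite addr_ge0 // mulr_ge0 // exprn_ge0.
  apply: ler_pM => //; try by apply: prodr_ge0.
  apply: le_trans (hP a); apply: ler_prod => j _; rewrite f0 lerD2l ler_wpM2l //.
  by rewrite exprS ler_piMl // exprn_ge0.
have B_rcons_p h p : B h (rcons p true) = A * r ^+ size p * B h p.
  rewrite /B /weight bitprod_rcons /ones -cats1 count_cat /= -/(ones p) -/(ones h).
  rewrite addn0 exprD !expr1; ring.
have B_rcons_h h p : B (rcons h true) p = A * r ^+ (size h).+1 * B h p.
  rewrite /B /weight bitprod_rcons /ones -cats1 count_cat /= -/(ones p) -/(ones h).
  rewrite addn0 exprD !expr1; ring.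
have cabs_cond (x : C) (e : bool) : cabs (x *+ e) <= cabs x.
  by case: e; rewrite ?mulr1n // mulr0n cabs0 cabs_ge0.
exists (A * M); first by rewrite mulr_ge0.
move=> a b; split.
- apply: (@le_trans _ _ M); last by rewrite ler_peMl.
  apply: le_trans (sumB a b).
  apply: le_trans (cabs_sum _ _ _) _; apply: ler_sum => h _.
  apply: le_trans (cabs_sum _ _ _) _; apply: ler_sum => p _.
  exact: le_trans (cabs_cond _ _) (obsB _ _).
- rewrite /corr -sumrB.
  under eq_bigr => h _.
    rewrite sum_masks_rcons big_split /=.
    under eq_bigr => p _.
      rewrite /ones -cats1 count_cat addn0 cats1 -/(ones p) -/(ones h) /obs /weight.
      rewrite bitprod_rcons expr0 mulr1.
      under eq_bigr do rewrite eigen_rcons_false.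
      over.
    rewrite addrAC subrr add0r.
    over.
  apply: (@le_trans _ _ (A * r ^+ b * \sum_(h <- masks a) \sum_(p <- masks b) B h p)); last first.
    by rewrite mulrAC ler_wpM2r ?exprn_ge0 // ler_wpM2l.
  rewrite big_distrr /=; apply: le_trans (cabs_sum _ _ _) _; apply: ler_sum => h _.
  rewrite big_distrr /=; apply: le_trans (cabs_sum _ _ _) _.
  rewrite big_seq [leRHS]big_seq; apply: ler_sum => p /size_masks sp.
  rewrite -sp -B_rcons_p; exact: le_trans (cabs_cond _ _) (obsB _ _).
- rewrite /corr sum_masks_rcons big_split /=.
  under eq_bigr => h _.
    under eq_bigr => p _.
      rewrite /ones -cats1 count_cat addn0 cats1 -/(ones p) -/(ones h) /obs /weight.
      rewrite bitprod_rcons expr0 mulr1.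
      under eq_bigr do rewrite eigen_rcons_false.
      over.
    over.
  rewrite /= addrAC subrr add0r.
  apply: (@le_trans _ _ (A * r ^+ a.+1 * \sum_(h <- masks a) \sum_(p <- masks b) B h p));
    last first.
    rewrite mulrAC; apply: ler_pM; rewrite ?exprn_ge0 ?mulr_ge0 ?ler_wpM2l //.
      by apply: sumr_ge0 => h _; apply: sumr_ge0.
    by rewrite exprS ler_piMl // exprn_ge0.
  rewrite big_distrr /=; apply: le_trans (cabs_sum _ _ _) _.
  rewrite big_seq [leRHS]big_seq; apply: ler_sum => h /size_masks sh.
  rewrite big_distrr /=; apply: le_trans (cabs_sum _ _ _) _; apply: ler_sum => p _.
  rewrite -sh -B_rcons_h; exact: le_trans (cabs_cond _ _) (obsB _ _).
Qed.

(** Shifting a sector of nonzero charge to charge 0 unbalances the window, so the limit must be the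
    same for every fixed imbalance [m]. *)
Lemma cvg_corr (S : {set I}) : exists Y : C, forall m,
  cvgC (fun n => corr q t (n + m) n S) Y /\ cvgC (fun n => corr q t n (n + m) S) Y.
Proof.
have [M M0 hM] := corr_bounds S.
have [Y [hY _]] : exists l : C, cvgC (fun n => corr q t n n S) l /\
    forall n, cabs (corr q t n n S - l) <= (M + M) / (1 - r) * r ^+ n.
  apply: cvgC_geometric_cauchy => // n.
  have [_ h1 _] := hM n.+1 n; have [_ _ h2] := hM n n.
  rewrite mulrDl; apply: le_trans (lerD h1 h2); apply: le_trans (cabsD _ _).
  by rewrite addrA subrK.
have small (v w : nat -> C) : cvgC v Y ->
    (forall n, cabs (w n - v n) <= M * r ^+ n) -> cvgC w Y.
  move=> vY hw; rewrite -[Y]addr0 (_ : w = fun n => v n + (w n - v n)).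
    by apply: cvgCD => //; apply: cvgC_geometric r01 _ => n; rewrite subr0.
  by apply/funext => n; rewrite addrC subrK.
exists Y; elim=> [|m [IH1 IH2]]; first by split; under eq_fun => n do rewrite addn0.
split; [apply: small IH1 _ | apply: small IH2 _] => n; rewrite addnS.
  have [_ _] := hM (n + m)%N n; move/le_trans; apply; apply: ler_wpM2l => //.
  case/andP: r01 => r0 r1; rewrite exprD; apply: ler_piMr; rewrite ?exprn_ge0 //.
  by rewrite exprn_ile1 // ltW.
have [_ + _] := hM n (n + m)%N; move/le_trans; apply; apply: ler_wpM2l => //.
case/andP: r01 => r0 r1; rewrite exprD; apply: ler_piMr; rewrite ?exprn_ge0 //.
by rewrite exprn_ile1 // ltW.
Qed.

End CorrBounds.

(** * Theta series *)

Section ThetaSeries.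
Context {R : realType}.
Local Notation C := R[i].

Lemma theta_dominated (r rho : R) k : 0 <= r < 1 -> 0 <= rho ->
  exists2 K : R, 0 <= K & forall j,
    r ^+ 'C(j.+1, 2) * ((j.*2.+1)%:R / 2) ^+ k * rho ^+ j.*2.+1 <= K * 2^-1 ^+ j.
Proof.
move=> r01 rho0; have [r0 r1] := andP r01.
(* [B] absorbs the polynomial factor through [n <= 2 ^ n]. Passing from [i] to [i.+1] multiplies the
   Gaussian term by [D * r ^+ i.+1], where the 2 in [D] pays for the decay [2^-1 ^+ j]. *)
pose B := 2 ^+ k * rho; pose D := 2 * B ^+ 2.
have B0 : 0 <= B by rewrite mulr_ge0 // exprn_ge0.
have D0 : 0 <= D by rewrite mulr_ge0 // exprn_ge0.
have [P P1 hP] := prod_geometric_bounded r01 D0.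
have P0 : 0 <= P := le_trans ler01 P1.
exists (B * P * r ^+ 0); first by rewrite expr0 mulr1 mulr_ge0.
move=> j; rewrite expr0 mulr1.
have h1 : ((j.*2.+1)%:R / 2) ^+ k * rho ^+ j.*2.+1 <= B ^+ j.*2.+1.
  rewrite /B [leRHS]exprMn -exprM mulnC exprM; apply: ler_wpM2r; first exact: exprn_ge0.
  apply: lerXn2r; rewrite ?nnegrE ?exprn_ge0 ?divr_ge0 //.
  rewrite ler_pdivrMr //; apply: le_trans (_ : 2 ^+ j.*2.+1 <= _); last first.
    by rewrite ler_peMr ?exprn_ge0 // ler1n.
  by rewrite -natrX ler_nat ltnW // ltn_expl.
have h2 i : r ^+ 'C(i.+1, 2) * (B ^+ i.*2 * 2 ^+ i) <= \prod_(l < i) (1 + D * r ^+ l).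
  elim: i => [|i IH]; first by rewrite bin_small // !expr0 !mulr1 big_ord0.
  rewrite big_ord_recr /= binS bin1 doubleS.
  have -> : r ^+ ('C(i.+1, 2) + i.+1) * (B ^+ i.*2.+2 * 2 ^+ i.+1) =
    (r ^+ 'C(i.+1, 2) * (B ^+ i.*2 * 2 ^+ i)) * (D * r ^+ i.+1).
    by rewrite /D exprD !exprS; ring.
  apply: ler_pM => //; rewrite ?mulr_ge0 ?exprn_ge0 //.
  apply: (@le_trans _ _ (D * r ^+ i)); last by rewrite lerDr.
  by rewrite ler_wpM2l // exprS ler_piMl ?exprn_ge0 // ltW.
rewrite -mulrA -(ler_pM2r (_ : 0 < 2 ^+ j)) ?exprn_gt0 //.
rewrite exprVn -[leRHS]mulrA mulVf ?expf_neq0 // mulr1.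
apply: (@le_trans _ _ (r ^+ 'C(j.+1, 2) * B ^+ j.*2.+1 * 2 ^+ j)).
  by rewrite ler_wpM2r ?exprn_ge0 // ler_wpM2l ?exprn_ge0.
apply: (@le_trans _ _ (B * (r ^+ 'C(j.+1, 2) * (B ^+ j.*2 * 2 ^+ j)))).
  by rewrite le_eqVlt; apply/orP; left; apply/eqP; rewrite exprS; ring.
by rewrite ler_wpM2l // (le_trans (h2 j)).
Qed.

Context (q : C) (q_lt1 : cabs q < 1).

(* Up to a constant factor, [Theta^(k)(x^2)] is the sum over [j >= 0] of
   [theta_coef k j * (x^(2j+1) - (-1)^k x^-(2j+1))]; [theta_half] collects the
   positive powers. *)
Definition theta_coef (k j : nat) : C :=
  (-1) ^+ j * q ^+ 'C(j.+1, 2) * ((j.*2.+1)%:R / 2) ^+ k.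

Definition theta_half_part (k : nat) (x : C) (n : nat) : C :=
  \sum_(j < n) theta_coef k j * x ^+ j.*2.+1.

Definition theta_half (k : nat) (x : C) : C :=
  limn (theta_half_part k x : nat -> C^o).

Let half01 : 0 <= (2^-1 : R) < 1.
Proof. by rewrite invr_ge0 ler0n invf_lt1 ?ltr1n ?ltr0n. Qed.

Lemma cabs_theta_coef k j :
  cabs (theta_coef k j) = cabs q ^+ 'C(j.+1, 2) * ((j.*2.+1)%:R / 2) ^+ k.
Proof. by rewrite !cabsM !cabsX cabsN cabs1 expr1n mul1r cabsM cabsV !cabs_nat. Qed.

Lemma theta_term_dominated k (rho : R) : 0 <= rho ->
  exists2 K : R, 0 <= K & forall j (x : C), cabs x <= rho ->
    cabs (theta_coef k j * x ^+ j.*2.+1) <= K * 2^-1 ^+ j.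
Proof.
move=> rho0; have r01 : 0 <= cabs q < 1 by rewrite cabs_ge0 q_lt1.
have [K K0 hK] := theta_dominated k r01 rho0; exists K => // j x xrho.
apply: le_trans (hK j); rewrite cabsM cabs_theta_coef cabsX.
apply: ler_wpM2l; first by rewrite mulr_ge0 ?exprn_ge0 ?cabs_ge0 ?divr_ge0.
by apply: lerXn2r; rewrite ?nnegrE ?cabs_ge0.
Qed.

Lemma theta_half_approx k (rho : R) : 0 <= rho ->
  exists2 K : R, 0 <= K & forall n (x : C), cabs x <= rho ->
    cabs (theta_half_part k x n - theta_half k x) <= K * 2^-1 ^+ n.
Proof.
move=> rho0; have [K K0 hK] := theta_term_dominated k rho0.
exists (K / (1 - 2^-1)) => [|n x xrho].
  by rewrite divr_ge0 // subr_ge0; case/andP: half01 => _ /ltW.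
have [|l [/cvgC_lim lE]] := @cvgC_geometric_cauchy R (theta_half_part k x) K _ half01.
  move=> m; rewrite /theta_half_part big_ord_recr /= addrAC subrr add0r.
  exact: hK.
by rewrite /theta_half lE; apply.
Qed.

Lemma cvg_theta_half k x : cvgC (theta_half_part k x) (theta_half k x).
Proof.
have [K _ hK] := theta_half_approx k (cabs_ge0 x).
by apply: cvgC_geometric half01 _ => n; apply: hK.
Qed.

Definition theta_series (k : nat) (x : C) : C :=
  theta_half k x - (-1) ^+ k * theta_half k x^-1.

(** The dependence on [m] is explicit, so that the remainders can be summed against the theta
    coefficients. *)
Lemma cabs_taylor_expr (x h : C) m : cabs h <= 1 ->
  cabs ((x + h) ^+ m.+1 - x ^+ m.+1 - h * (m.+1%:R * x ^+ m)) <=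
  cabs h ^+ 2 * (m.+1%:R ^+ 2 * (cabs x + 2) ^+ m.+1).
Proof.
move=> h1; set y := cabs x + 2; have x0 := cabs_ge0 x; have h0 := cabs_ge0 h.
have y1 : 1 <= y by rewrite /y; lra.
elim: m => [|m IH].
  rewrite (_ : _ - _ - _ = 0) ?cabs0; last by rewrite !expr1 expr0; ring.
  by rewrite !mulr_ge0 ?exprn_ge0 // (le_trans ler01).
have -> : (x + h) ^+ m.+2 - x ^+ m.+2 - h * (m.+2%:R * x ^+ m.+1) =
  (x + h) * ((x + h) ^+ m.+1 - x ^+ m.+1 - h * (m.+1%:R * x ^+ m)) +
  h ^+ 2 * (m.+1%:R * x ^+ m).
  rewrite [(x + h) ^+ m.+2]exprS [x ^+ m.+2]exprS [x ^+ m.+1]exprS -[m.+2%:R]natr1; ring.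
apply: le_trans (cabsD _ _) _; rewrite !cabsM !cabsX cabs_nat.
have xh : cabs (x + h) <= y by apply: le_trans (cabsD _ _) _; rewrite /y; lra.
have e1 := ler_pM (cabs_ge0 _) (cabs_ge0 _) xh IH.
have e2 : cabs h ^+ 2 * (m.+1%:R * cabs x ^+ m) <= cabs h ^+ 2 * (m.+1%:R * y ^+ m.+2).
  rewrite ler_wpM2l ?exprn_ge0 // ler_wpM2l //.
  apply: (@le_trans _ _ (y ^+ m)); first by apply: lerXn2r; rewrite ?nnegrE /y; lra.
  by apply: ler_weXn2l => //; rewrite leqW.
apply: le_trans (lerD e1 e2) _.
have -> : y * (cabs h ^+ 2 * (m.+1%:R ^+ 2 * y ^+ m.+1)) = cabs h ^+ 2 * (m.+1%:R ^+ 2 * y ^+ m.+2).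
  by rewrite [y ^+ m.+2]exprS; ring.
rewrite -mulrDr -mulrDl ler_wpM2l ?exprn_ge0 // ler_wpM2r ?exprn_ge0 //.
  by rewrite (le_trans ler01).
by rewrite -[m.+2%:R]natr1 sqrrD; have : 0 <= m.+1%:R :> R by []; lra.
Qed.

Lemma theta_half_taylor k (x : C) : x != 0 ->
  exists2 K : R, 0 <= K & forall h, cabs h <= 1 ->
    cabs (theta_half k (x + h) - theta_half k x - h * (2 * theta_half k.+1 x / x)) <=
    K * cabs h ^+ 2.
Proof.
move=> x0; pose y : R := cabs x + 2.
have y0 : 0 <= y by rewrite addr_ge0 ?cabs_ge0.
have r01 : 0 <= cabs q < 1 by rewrite cabs_ge0 q_lt1.
(* The remainder of the power [2j + 1] carries [(2j + 1) ^ 2 = 4 * ((2j + 1) / 2) ^ 2], hence the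
   index [k.+2] and the factor 4. *)
have [K K0 hK] := theta_dominated k.+2 r01 y0.
have K1 : 0 <= 4 * (K / (1 - 2^-1)).
  by rewrite mulr_ge0 // divr_ge0 // subr_ge0; case/andP: half01 => _ /ltW.
exists (4 * (K / (1 - 2^-1))) => // h h1.
pose u n := theta_half_part k (x + h) n - theta_half_part k x n
  - h * (2 * theta_half_part k.+1 x n / x).
apply: (@cvgC_le _ u).
  apply: cvgCB; first by apply: cvgCB; exact: cvg_theta_half.
  apply: cvgCZ; apply: cvgCM (cvgC_cst _); apply: cvgCZ; exact: cvg_theta_half.
move=> n; have -> : u n = \sum_(j < n) theta_coef k j *
   ((x + h) ^+ j.*2.+1 - x ^+ j.*2.+1 - h * (j.*2.+1%:R * x ^+ j.*2)).
  rewrite /u /theta_half_part -sumrB mulrAC !big_distrr -sumrB.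
  apply: eq_bigr => j _ /=; rewrite /theta_coef.
  by move: (_ ^+ 'C(_, _)) => A; rewrite (exprS (_ / _)) (exprS x); field.
apply: le_trans (cabs_sum _ _ _) _.
apply: (@le_trans _ _ (\sum_(j < n) 4 * K * cabs h ^+ 2 * 2^-1 ^+ j)); last first.
  rewrite -big_distrr /= -(big_mkord predT (fun j => 2^-1 ^+ j)).
  have e (c : R) : 4 * (K * c) * cabs h ^+ 2 = 4 * K * cabs h ^+ 2 * c by ring.
  rewrite e ler_wpM2l //.
    by rewrite !mulr_ge0 ?exprn_ge0 ?cabs_ge0.
  by apply: le_trans (geometric_sum_le _ _ half01) _; rewrite expr0 mul1r.
apply: ler_sum => j _; rewrite cabsM cabs_theta_coef.
apply: (@le_trans _ _ (cabs q ^+ 'C(j.+1, 2) * ((j.*2.+1)%:R / 2) ^+ k *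
  (cabs h ^+ 2 * (j.*2.+1%:R ^+ 2 * y ^+ j.*2.+1)))).
  apply: ler_wpM2l; last exact: cabs_taylor_expr.
  by rewrite mulr_ge0 ?exprn_ge0 ?cabs_ge0 ?divr_ge0.
have := hK j; move: (_ ^+ 'C(_, _)) => A.
rewrite !(exprS (_ / _)) => hA.
have e : A * ((j.*2.+1)%:R / 2) ^+ k * (cabs h ^+ 2 * (j.*2.+1%:R ^+ 2 * y ^+ j.*2.+1)) =
  4 * cabs h ^+ 2 * (A * ((j.*2.+1)%:R / 2 * ((j.*2.+1)%:R / 2 * ((j.*2.+1)%:R / 2) ^+ k)) * y ^+
    j.*2.+1).
  by field.
rewrite e; have -> : 4 * K * cabs h ^+ 2 * 2^-1 ^+ j = 4 * cabs h ^+ 2 * (K * 2^-1 ^+ j) by ring.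
by rewrite ler_wpM2l // mulr_ge0 // exprn_ge0 ?cabs_ge0.
Qed.

End ThetaSeries.

(** * Derivatives with a quadratic remainder *)

Section QuadraticDerivative.
Context {R : realType}.
Local Notation C := R[i].

(* Differentiability with a quadratic remainder, which every analytic function
   satisfies and which composes without filters. *)
Definition has_qderiv (f : C -> C) (a D : C) : Prop :=
  exists K d : R, [/\ 0 <= K, 0 < d & forall h, cabs h <= d ->
    cabs (f (a + h) - f a - h * D) <= K * cabs h ^+ 2].

Lemma has_qderiv_eq (f g : C -> C) a D (d : R) : 0 < d ->
  (forall h, cabs h <= d -> f (a + h) = g (a + h)) ->
  has_qderiv g a D -> has_qderiv f a D.
Proof.
move=> d0 fg [K [d' [K0 d'0 H]]]; exists K, (Num.min d d'); split=> //.
  by rewrite lt_min d0.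
move=> h; rewrite le_min => /andP[hd hd']; rewrite fg // -[X in f X]addr0 fg ?addr0 ?H //.
by rewrite cabs0 ltW.
Qed.

Lemma has_qderivB (f g : C -> C) a D E :
  has_qderiv f a D -> has_qderiv g a E -> has_qderiv (fun x => f x - g x) a (D - E).
Proof.
move=> [K [d [K0 d0 H]]] [K' [d' [K'0 d'0 H']]].
exists (K + K'), (Num.min d d'); split; rewrite ?addr_ge0 ?lt_min ?d0 //.
move=> h; rewrite le_min => /andP[/H h1 /H' h2].
rewrite mulrDl; apply: le_trans (lerD h1 h2); apply: le_trans (cabsB _ _).
by rewrite le_eqVlt; apply/orP; left; apply/eqP; congr cabs; ring.
Qed.

Lemma has_qderivZ c (f : C -> C) a D :
  has_qderiv f a D -> has_qderiv (fun x => c * f x) a (c * D).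
Proof.
move=> [K [d [K0 d0 H]]]; exists (cabs c * K), d; split; rewrite ?mulr_ge0 ?cabs_ge0 //.
move=> h /H h1; rewrite (_ : _ - _ - _ = c * (f (a + h) - f a - h * D)); last by ring.
by rewrite cabsM -mulrA ler_wpM2l ?cabs_ge0.
Qed.

Lemma has_qderivV a : a != 0 -> has_qderiv (fun x => x^-1) a (- a ^- 2).
Proof.
move=> a0; have A0 : 0 < cabs a by rewrite cabs_gt0.
exists (2 / cabs a ^+ 3), (cabs a / 2); split.
- by rewrite divr_ge0 // exprn_ge0 // ltW.
- by rewrite divr_gt0.
move=> h hA; have ah : cabs a / 2 <= cabs (a + h).
  by have := cabsB (a + h) h; rewrite addrK; lra.
have ah0 : a + h != 0 by rewrite -cabs_gt0; lra.
rewrite (_ : _ - _ - _ = h ^+ 2 * (a ^- 2 * (a + h)^-1)); last by field; rewrite a0 ah0.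
rewrite !cabsM !cabsV !cabsX mulrC ler_wpM2r ?mulr_ge0 ?cabs_ge0 //.
have -> : 2 / cabs a ^+ 3 = cabs a ^- 2 * (cabs a / 2)^-1 by field; rewrite lt0r_neq0.
rewrite ler_wpM2l ?invr_ge0 ?exprn_ge0 ?cabs_ge0 // lef_pV2 // posrE; lra.
Qed.

Lemma has_qderiv_comp (f g : C -> C) a D E :
  has_qderiv f a D -> has_qderiv g (f a) E -> has_qderiv (g \o f) a (D * E).
Proof.
move=> [K [d [K0 d0 H]]] [K' [d' [K'0 d'0 H']]].
(* [L] bounds the increment of [f] by [L * cabs h] when [cabs h <= 1]. *)
pose L := cabs D + K + 1; have D0 := cabs_ge0 D.
have L0 : 0 < L by rewrite /L; lra.
exists (K' * L ^+ 2 + K * cabs E), (Num.min (Num.min d 1) (d' / L)); split.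
- by rewrite addr_ge0 // mulr_ge0 ?cabs_ge0 ?exprn_ge0 ?(ltW L0).
- by rewrite !lt_min d0 ltr01 divr_gt0.
move=> h; rewrite !le_min => /andP[/andP[hd h1] hd'] /=.
have h0 := cabs_ge0 h; set u := f (a + h) - f a.
have r1 : cabs (u - h * D) <= K * cabs h ^+ 2 by exact: H.
have uL : cabs u <= L * cabs h.
  have := cabsD (u - h * D) (h * D); rewrite subrK cabsM.
  have : K * cabs h ^+ 2 <= K * cabs h.
    by rewrite ler_wpM2l // expr2 ler_piMr.
  by rewrite /L; nra.
have ud : cabs u <= d'.
  by apply: le_trans uL _; rewrite mulrC -ler_pdivlMr.
have r2 : cabs (g (f a + u) - g (f a) - u * E) <= K' * cabs u ^+ 2 by exact: H'.
have -> : f (a + h) = f a + u by rewrite /u [RHS]addrC subrK.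
rewrite (_ : _ - _ - _ = (g (f a + u) - g (f a) - u * E) + (u - h * D) * E); last by ring.
apply: le_trans (cabsD _ _) _; rewrite [leRHS]mulrDl; apply: lerD.
  apply: le_trans r2 _; rewrite -mulrA -exprMn ler_wpM2l //.
  by apply: lerXn2r; rewrite ?nnegrE ?cabs_ge0 // mulr_ge0 // ltW.
by rewrite cabsM mulrAC ler_wpM2r ?cabs_ge0.
Qed.

Lemma derive1_qderiv (f : C -> C) (a D : C) :
  has_qderiv f a D -> derive1 (f : C^o -> C^o) a = D.
Proof.
move=> [K [d [K0 d0 H]]]; rewrite /derive1; apply: cvg_lim => //.
apply/cvgrPdist_lt => /= e e0.
have eR : e = (complex.Re e)%:C by case: e e0 => x y; rewrite ltcE /= => /andP[/eqP ->].
have e0' : 0 < complex.Re e by move: e0; rewrite ltcE => /andP[].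
pose d2 := Num.min d (complex.Re e / (K + 1)).
have K10 : 0 < K + 1 by lra.
have d20 : 0 < d2 by rewrite lt_min d0 divr_gt0.
near=> h.
have h0 : (h : C^o) != 0 by near: h; exact: (@nbhs_dnbhs_neq C^o).
have hd : cabs h < d2.
  suff : `|h : C^o| < d2%:C by rewrite -[`|_|]/((cabs h)%:C) ltcR.
  by near: h; apply: (@dnbhs0_lt _ C^o); rewrite ltcR.
rewrite eR -[`|_|]/((cabs _)%:C) ltcR.
move: hd; rewrite lt_min => /andP[/ltW hd]; rewrite ltr_pdivlMr // => he.
rewrite cabs_distC; have := H h hd; rewrite [a + h]addrC.
have H0 : 0 < cabs h by rewrite cabs_gt0.
have -> : h^-1 *: (f (h + a) - f a : C^o) - D = h^-1 * (f (h + a) - f a - h * D).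
  by rewrite -[_ *: _]/(_ * _) [RHS]mulrBr mulKf.
move=> h1; rewrite cabsM cabsV ltr_pdivrMl //; apply: le_lt_trans h1 _.
by rewrite expr2 mulrCA ltr_pM2l //; nra.
Unshelve. all: by end_near.
Qed.

End QuadraticDerivative.

Section ThetaDerivatives.
Context {R : realType} (q : R[i]) (q_lt1 : cabs q < 1).
Local Notation C := R[i].

Lemma has_qderiv_theta_half k (x : C) : x != 0 ->
  has_qderiv (theta_half q k) x (2 * theta_half q k.+1 x / x).
Proof. by move=> /(theta_half_taylor q_lt1 k)[K K0 H]; exists K, 1; split. Qed.

Lemma has_qderiv_theta_series k (x : C) : x != 0 ->
  has_qderiv (theta_series q k) x (2 * theta_series q k.+1 x / x).
Proof.
move=> x0; rewrite (_ : 2 * _ / x = 2 * theta_half q k.+1 x / x -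
  (-1) ^+ k * (- x ^- 2 * (2 * theta_half q k.+1 x^-1 / x^-1))).
  apply: has_qderivB; first exact: has_qderiv_theta_half.
  apply: has_qderivZ; apply: (@has_qderiv_comp _ (fun x => x^-1)).
    exact: has_qderivV.
  by apply: has_qderiv_theta_half; rewrite invr_eq0.
rewrite /theta_series exprS invrK; move: (theta_half _ _ x) (theta_half _ _ x^-1) => a b.
by move: ((-1) ^+ k) => sg; field.
Qed.

Lemma euler_theta_series (K : C) (f : C -> C) k :
  (forall x, x != 0 -> f x = K * theta_series q k x) ->
  forall x, x != 0 -> euler (f : C^o -> C^o) x = K * theta_series q k.+1 x.
Proof.
move=> fE x x0; rewrite /euler.
rewrite (@derive1_qderiv _ f x (K * (2 * theta_series q k.+1 x / x))).
  by field.
have X0 : 0 < cabs x by rewrite cabs_gt0.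
apply: (@has_qderiv_eq _ _ (fun x => K * theta_series q k x) _ _ (cabs x / 2)).
- by rewrite divr_gt0.
- move=> h hx; apply: fE; rewrite -cabs_gt0.
  by have := cabsB (x + h) h; rewrite addrK; lra.
by apply: has_qderivZ; exact: has_qderiv_theta_series.
Qed.

Lemma thetasD_theta_series (K : C) :
  (forall x, x != 0 -> thetas q x = K * theta_series q 0 x) ->
  forall k x, x != 0 -> thetasD q k x = K * theta_series q k x.
Proof. by move=> h0; elim=> [//|k IH]; exact: euler_theta_series. Qed.

End ThetaDerivatives.

(** * The recursion for the correlators *)

Section Relations.
Context {R : realType}.
Local Notation C := R[i].

(** Dominated convergence when all columns [b^~ j] share the limit [B]: replace [b N j] by [B], then
    control the error by a fixed head, which tends to 0, and a geometric tail. *)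
Lemma tannery (w : nat -> C) (b : nat -> nat -> C) (W B : C) (K M r : R) : 0 <= r < 1 ->
  (forall j, cabs (w j) <= K * r ^+ j) -> (forall N j, cabs (b N j) <= M) ->
  (forall j, cvgC (b^~ j) B) -> cvgC (fun n => \sum_(j < n) w j) W ->
  cvgC (fun N => \sum_(j < N.+1) w j * b N j) (W * B).
Proof.
move=> r01 hw hb cb cw.
have K0 : 0 <= K by have := hw 0; rewrite expr0 mulr1; apply: le_trans; exact: cabs_ge0.
have M0 : 0 <= M by apply: le_trans (hb 0 0); exact: cabs_ge0.
have MB0 : 0 <= M + cabs B by rewrite addr_ge0 // cabs_ge0.
rewrite (_ : (fun N => _) = fun N => (\sum_(j < N.+1) w j) * B + \sum_(j < N.+1) w j *
  (b N j - B)); last first.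
  apply/funext => N; rewrite big_distrl -big_split; apply: eq_bigr => j _ /=.
  by rewrite mulrBr addrC subrK.
rewrite -[W * B]addr0; apply: cvgCD.
  apply: cvgCM (cvgC_cst _).
  by have := cvgC_shift 1 cw; congr cvgC; apply/funext => N; rewrite addn1.
move=> e e0; have e20 : 0 < e / 2 by rewrite divr_gt0.
have [J hJ] := geometric_small (K * (M + cabs B) / (1 - r)) r01 e20.
have small : cvgC (fun N => \sum_(j < J) w j * (b N j - B)) (\sum_(j < J) w j * (B - B)).
  by apply: cvgC_sum => j _; apply/cvgCZ/cvgCB => //; exact: cvgC_cst.
rewrite big1 in small => [|j _]; last by rewrite subrr mulr0.
have [N1 hN1] := small _ e20; exists (maxn N1 J) => N; rewrite geq_max => /andP[n1 nJ].
rewrite subr0 -(big_mkord predT (fun j => w j * (b N j - B))) (@big_cat_nat _ _ _ J) //=;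
  last by rewrite leqW.
have := hN1 N n1; rewrite subr0 -(big_mkord predT (fun j => w j * (b N j - B))) => h1.
apply: le_lt_trans (cabsD _ _) _; rewrite [ltRHS](splitr e); apply: ltr_leD => //.
apply/ltW; apply: le_lt_trans (hJ J (leqnn J)); apply: le_trans (cabs_sum _ _ _) _.
apply: (@le_trans _ _ (K * (M + cabs B) * \sum_(J <= j < N.+1) r ^+ j)).
  rewrite big_distrr; apply: ler_sum => j _ /=; rewrite cabsM mulrAC.
  apply: ler_pM; rewrite ?cabs_ge0 //.
  by apply: le_trans (cabsB _ _) _; rewrite lerD2r.
by rewrite [leRHS]mulrAC -[leRHS]mulrA ler_wpM2l ?mulr_ge0 // geometric_sum_le.
Qed.

Context (q : C) (q_neq0 : q != 0) (q_lt1 : cabs q < 1).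

Let r01 : 0 <= cabs q < 1. Proof. by rewrite cabs_ge0 q_lt1. Qed.

Lemma cvg_qpoch (a : C) : cvgC (fun N => \prod_(j < N) (1 - a * q ^+ j)) (qpoch q a).
Proof.
have [P P1 hP] := prod_geometric_bounded r01 (cabs_ge0 a).
have [|l [cl _]] := @cvgC_geometric_cauchy R (fun N => \prod_(j < N) (1 - a * q ^+ j)) (P *
  cabs a) _ r01.
  move=> n; rewrite big_ord_recr /= (_ : _ - _ = - ((\prod_(j < n) (1 - a * q ^+ j)) * (a * q ^+
    n))); last by ring.
  rewrite cabsN !cabsM cabsX mulrA ler_wpM2r ?exprn_ge0 ?cabs_ge0 // ler_wpM2r ?cabs_ge0 //.
  rewrite cabs_prod; apply: le_trans (hP n); apply: ler_prod => j _; rewrite cabs_ge0 /=.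
  by apply: le_trans (cabsB _ _) _; rewrite cabs1 cabsM cabsX.
by rewrite /qpoch (cvgC_lim cl).
Qed.

Context {I : finType} (s : I -> C).
Hypotheses (s_unit : forall i, cabs (s i) = 1) (s2_neq1 : forall i, s i ^+ 2 != 1).

Let t i := s i ^+ 2.
Let t_unit i : cabs (t i) = 1. Proof. by rewrite cabsX s_unit expr1n. Qed.
Let t_neq0 i : t i != 0. Proof. by rewrite -cabs_eq0 t_unit oner_neq0. Qed.

Lemma sqr_exprS (x : C) j : (x ^+ 2) ^+ j.+1 = x * x ^+ j.*2.+1.
Proof. by rewrite -exprM mul2n doubleS exprS. Qed.

Lemma sqr_exprV (x : C) j : x != 0 -> ((x ^+ 2) ^+ j)^-1 = x * x^-1 ^+ j.*2.+1.
Proof. by move=> x0; rewrite -exprM mul2n exprS mulrA mulfV // mul1r exprVn. Qed.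

(** [chi] depends only on the charge: [al j] is its value at charge [j + 1] and [be j] its value at
    charge [- j]. The window [N], [N.+1] holds exactly these charges for [j <= N], and the paired
    sectors have the same power of [q]. *)
Lemma sum_by_charge_corr (S : {set I}) (chi : nat -> nat -> C) (al be : nat -> C) N :
  (forall j h, chi (j.+1 + h)%N h = al j) -> (forall j p, chi p (j + p)%N = be j) ->
  \sum_(h <- masks N) \sum_(p <- masks N.+1) chi (ones p) (ones h) * obs q t S h p =
  \sum_(j < N.+1) q ^+ 'C(j.+1, 2) *
    (al j * (\prod_(i in S) t i) ^+ j.+1 * corr q t (N + j.+1) (N - j) S +
     be j / (\prod_(i in S) t i) ^+ j * corr q t (N - j) (N + j.+1) S).
Proof.
move=> hal hbe; rewrite sum_by_charge; apply: eq_bigr => j _; have jN : (j <= N)%N by rewrite -ltnS.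
rewrite mulrDr; congr (_ + _).
  rewrite (_ : q ^+ _ * _ = al j * (q ^+ 'C(j.+1, 2) * (\prod_(i in S) t i) ^+ j.+1 *
    corr q t (N + j.+1) (N - j) S)); last by ring.
  rewrite -sum_charge // addnS subnK // big_distrr; apply: eq_bigr => h _ /=.
  rewrite big_distrr; apply: eq_bigr => p _ /=.
  by case: eqP => [->|_]; rewrite ?mulr1n ?hal // !mulr0n mulr0.
rewrite (_ : q ^+ _ * _ = be j * (q ^+ 'C(j.+1, 2) / (\prod_(i in S) t i) ^+ j * corr q t (N - j)
  (N + j.+1) S)); last by ring.
rewrite addnS -addSn -sum_chargeN // subnK // big_distrr; apply: eq_bigr => h _ /=.
rewrite big_distrr; apply: eq_bigr => p _ /=.
by case: eqP => [->|_]; rewrite ?mulr1n ?hbe // !mulr0n mulr0.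
Qed.

Lemma cvg_theta_corr (S : {set I}) (Y x : C) k : x != 0 ->
  (forall m, cvgC (fun n => corr q t (n + m) n S) Y /\
             cvgC (fun n => corr q t n (n + m) S) Y) ->
  cvgC (fun N => \sum_(j < N.+1)
     (theta_coef q k j * x ^+ j.*2.+1 * corr q t (N + j.+1) (N - j) S -
      (-1) ^+ k * (theta_coef q k j * x^-1 ^+ j.*2.+1 * corr q t (N - j) (N + j.+1) S)))
   (theta_series q k x * Y).
Proof.
move=> x0 hY; rewrite /theta_series mulrBl -mulrA.
have [M M0 hM] := corr_bounds q_lt1 t_unit S.
under eq_fun => N do rewrite sumrB -big_distrr.
apply: cvgCB; last apply: cvgCZ.
- have [K K0 hK] := theta_term_dominated q_lt1 k (cabs_ge0 x).
  have half01 : 0 <= (2^-1 : R) < 1 by rewrite invr_ge0 ler0n invf_lt1 ?ltr1n ?ltr0n.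
  apply: (@tannery (fun j => theta_coef q k j * x ^+ j.*2.+1)
    (fun N j => corr q t (N + j.+1) (N - j) S) _ _ K M _ half01) => [j|N j|j|].
  + exact: hK.
  + by have [] := hM (N + j.+1)%N (N - j)%N.
  (* The two cutoffs differ by [2j + 1]; with [n = N - j] this is a fixed imbalance. *)
  + apply: (@cvgC_unshift _ j); have [h _] := hY (j + j.+1)%N.
    by move: h; congr cvgC; apply/funext => n; rewrite addnK addnA.
  + exact: cvg_theta_half.
- have [K K0 hK] := theta_term_dominated q_lt1 k (cabs_ge0 x^-1).
  have half01 : 0 <= (2^-1 : R) < 1 by rewrite invr_ge0 ler0n invf_lt1 ?ltr1n ?ltr0n.
  apply: (@tannery (fun j => theta_coef q k j * x^-1 ^+ j.*2.+1)
    (fun N j => corr q t (N - j) (N + j.+1) S) _ _ K M _ half01) => [j|N j|j|].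
  + exact: hK.
  + by have [] := hM (N - j)%N (N + j.+1)%N.
  + apply: (@cvgC_unshift _ j); have [_ h] := hY (j + j.+1)%N.
    by move: h; congr cvgC; apply/funext => n; rewrite addnK addnA.
  + exact: cvg_theta_half.
Qed.

Definition corr_lim (S : {set I}) : C := limn (fun n => corr q t n n S : C^o).

Lemma cvg_corr_lim S m :
  cvgC (fun n => corr q t (n + m) n S) (corr_lim S) /\
  cvgC (fun n => corr q t n (n + m) S) (corr_lim S).
Proof.
have [Y hY] := cvg_corr q_lt1 t_unit S.
suff -> : corr_lim S = Y by exact: hY.
by apply: cvgC_lim; have [+ _] := hY 0; congr cvgC; apply/funext => n; rewrite addn0.
Qed.

Definition sprod (S : {set I}) : C := \prod_(i in S) s i.

Let sprod_neq0 S : sprod S != 0.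
Proof. by apply/prodf_neq0 => i _; rewrite -cabs_eq0 s_unit oner_neq0. Qed.

(** Give each state the factor [(- x ^ 2)] to its charge. The sum over all states is a product by
    [sum_weight], and grouped by charge it is a theta series times the charge 0 sum. *)
Lemma jacobi_triple x : x != 0 ->
  thetas q x = (qpoch q q)^-2 * corr_lim finset.set0 * theta_series q 0 x.
Proof.
(* Pulling out [x] turns the powers [2j + 2] and [- 2j] into the opposite odd powers of
   [theta_series]. *)
move=> x0; pose u N := - x * \sum_(j < N.+1)
     (theta_coef q 0 j * x ^+ j.*2.+1 * corr q t (N + j.+1) (N - j) finset.set0 -
      (-1) ^+ 0 * (theta_coef q 0 j * x^-1 ^+ j.*2.+1 * corr q t (N - j) (N + j.+1) finset.set0)).
have u1 : cvgC u (- x * (theta_series q 0 x * corr_lim finset.set0)).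
  by apply: cvgCZ; apply: cvg_theta_corr => // m; exact: cvg_corr_lim.
have u2 : cvgC u ((1 - x ^+ 2) * qpoch q (q * x ^+ 2) * qpoch q (q / x ^+ 2)).
  have -> : u = fun N => (1 - x ^+ 2) * (\prod_(j < N) (1 - (q * x ^+ 2) * q ^+ j)) *
    \prod_(j < N) (1 - (q / x ^+ 2) * q ^+ j).
    apply/funext => N.
    have := sum_weight q (- x ^+ 2) (- x ^- 2) N N.+1.
    rewrite big_ord_recl expr0 mulr1 => e.
    transitivity ((1 - x ^+ 2) * (\prod_(i < N) (1 + - x ^+ 2 * q ^+ bump 0 i)) *
       \prod_(j < N) (1 + - x ^- 2 * q ^+ j.+1)); last first.
      congr (_ * _ * _); apply: eq_bigr => j _; rewrite ?/bump ?leq0n ?add1n [q ^+ _.+1]exprS; ring.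
    rewrite -e; have := @sum_by_charge_corr finset.set0 (fun p h => (- x ^+ 2) ^+ p * (- x ^- 2)
      ^+ h)
      (fun j => (- x ^+ 2) ^+ j.+1) (fun j => (- x ^- 2) ^+ j) N.
    under [X in _ -> _ -> X = _]eq_bigr => h _ do under eq_bigr => p _ do rewrite /obs big_set0 mulr1.
    have xx : - x ^+ 2 * - x ^- 2 = 1 by rewrite mulrNN mulfV // expf_neq0.
    move=> ->.
    - rewrite /u big_distrr; apply: eq_bigr => j _ /=; rewrite big_set0 /theta_coef !expr1n !expr0.
      rewrite invr1 !mulr1 mul1r [(- x ^+ 2) ^+ _]exprNn [(- x ^- 2) ^+ _]exprNn.
      rewrite [_^-1 ^+ j]exprVn sqr_exprS sqr_exprV // [(-1) ^+ j.+1]exprS; ring.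
    - by move=> j h; rewrite exprD -mulrA -exprMn xx expr1n mulr1.
    - by move=> j p; rewrite exprD mulrCA -exprMn xx expr1n mulr1.
  by apply: cvgCM; [apply: cvgCZ|]; exact: cvg_qpoch.
have e := cvgC_uniq u1 u2.
rewrite /thetas -!mulrA; congr (_ * _).
apply: (mulfI (_ : - x != 0)); first by rewrite oppr_eq0.
rewrite [corr_lim _ * _]mulrC e; rewrite !mulrA; congr (_ * _ * _).
by field.
Qed.

(* The limit of [sum_toggle] with [c = 1/2]. By [sum_charge] the states of
   charge [c] contribute [q^(c(c-1)/2) t^c] times a correlator that no longer
   depends on [c] in the limit, so that the sum over [c] is a theta series. *)
Lemma corr_lim_relation (S : {set I}) :
  \sum_(B : {set I} | B \subset S) (-1) ^+ #|S :\: B| * theta_series q #|S :\: B| (sprod B) *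
    (sprod B * corr_lim B) = 0.
Proof.
(* For [t = s ^ 2], the powers [t ^ (j + 1)] and [t ^ (- j)] are [s] times [s ^ (2j + 1)] and
   [s ^ (- 2j - 1)]; the common [s] is [sprod B]. *)
pose v (B : {set I}) N := - sprod B * (-1) ^+ #|S :\: B| * \sum_(j < N.+1)
     (theta_coef q #|S :\: B| j * sprod B ^+ j.*2.+1 * corr q t (N + j.+1) (N - j) B -
      (-1) ^+ #|S :\: B| * (theta_coef q #|S :\: B| j * (sprod B)^-1 ^+ j.*2.+1 *
        corr q t (N - j) (N + j.+1) B)).
have v1 : cvgC (fun N => \sum_(B : {set I} | B \subset S) v B N) (\sum_(B : {set I} | B \subset S)
   (- sprod B * (-1) ^+ #|S :\: B| * (theta_series q #|S :\: B| (sprod B) * corr_lim B))).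
  apply: cvgC_sum => B _; apply: cvgCZ; apply: cvg_theta_corr => // m; exact: cvg_corr_lim.
have v2 : cvgC (fun N => \sum_(B : {set I} | B \subset S) v B N) 0.
  rewrite (_ : (fun N => _) = fun=> 0); first exact: cvgC_cst.
  apply/funext => N; have := sum_toggle q t S 2^-1 N N.
  have expand h p : (-1) ^+ ones p * (-1) ^+ ones h *
    (weight q h p * \prod_(i in S) (eigen (t i) h p + ((ones h)%:R - (ones p)%:R + 2^-1))) =
    \sum_(B : {set I} | B \subset S) ((-1) ^+ ones p * (-1) ^+ ones h *
      ((ones h)%:R - (ones p)%:R + 2^-1) ^+ #|S :\: B|)
      * obs q t B h p.
    rewrite prod_add_const !big_distrr; apply: eq_bigr => B _ /=.
    by rewrite /obs; ring.
  under eq_bigr => h _ do (under eq_bigr => p _ do rewrite expand; rewrite exchange_big).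
  rewrite exchange_big /= => e; rewrite -[RHS]e; apply: eq_bigr => B _.
  rewrite (@sum_by_charge_corr _ (fun p h => (-1) ^+ p * (-1) ^+ h * (h%:R - p%:R + 2^-1) ^+
    #|S :\: B|)
     (fun j => - (-1) ^+ j * (-1) ^+ #|S :\: B| * ((j.*2.+1)%:R / 2) ^+ #|S :\: B|)
     (fun j => (-1) ^+ j * ((j.*2.+1)%:R / 2) ^+ #|S :\: B|)).
  - have -> : \prod_(i in B) t i = sprod B ^+ 2 by rewrite -prodrXl.
    rewrite /v big_distrr; apply: eq_bigr => j _ /=; rewrite /theta_coef.
    have p0 := sprod_neq0 B; move: (sprod _) p0 => x p0.
    rewrite sqr_exprS sqr_exprV //.
    have := sqrr_sign C #|S :\: B|; move: ((-1) ^+ #|S :\: B|) => sg sg2.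
    set y1 := x ^+ _; set y2 := _ ^-1 ^+ _; ring: sg2.
  - move=> j h; rewrite !exprD -!mulrA.
    rewrite (_ : h%:R - _ + _ = - ((j.*2.+1)%:R / 2)); last first.
      by rewrite !natrD -[j.*2.+1%:R]natr1 -[j.+1%:R]natr1 -muln2 natrM; field.
    rewrite [(- (_ / _)) ^+ _]exprNn [(-1) ^+ j.+1]exprS; have := sqrr_sign C h; move: ((-1) ^+
      h) => sg sg2; ring: sg2.
  - move=> j p; rewrite !exprD -!mulrA.
    rewrite (_ : _ - _ + _ = (j.*2.+1)%:R / 2); last first.
      by rewrite !natrD -[j.*2.+1%:R]natr1 -muln2 natrM; field.
    have := sqrr_sign C p; move: ((-1) ^+ p) => sg sg2; ring: sg2.
have := cvgC_uniq v1 v2 => e; apply: oppr_inj; rewrite oppr0 -[RHS]e -sumrN.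
by apply: eq_bigr => B _; ring.
Qed.

End Relations.

(** * Analytic continuation *)

Lemma dist_geq m n : (m <= n)%N -> ((n - m) + (m - n) = n - m)%N.
Proof. lia. Qed.

Section LaurentLimits.
Context {R : realType}.
Local Notation C := R[i].

Lemma complex_prim_root n : (0 < n)%N -> exists z : C, n.-primitive_root z.
Proof.
move=> n_gt0; pose p : {poly C} := 'X^n - 1; have [r Dp] := closed_field_poly_normal p.
rewrite (monicP _) ?monicXnsubC // scale1r in Dp.
have rn1 : all n.-unity_root r by apply/allP=> z; rewrite -root_prod_XsubC -Dp.
have sz_r : (n < (size r).+1)%N.
  by rewrite -(size_prod_XsubC r id) -Dp size_XnsubC.
have [|z] := hasP (has_prim_root n_gt0 rn1 _ sz_r); last by exists z.
by rewrite -separable_prod_XsubC -Dp separable_Xn_sub_1 // pnatr_eq0 -lt0n.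
Qed.

(** With as many roots of unity as [P] has coefficients, the discrete average extracts a coefficient
    exactly and replaces the contour integral. *)
Lemma cauchy_estimate (P : {poly C}) (r B : R) i : 0 < r ->
  (forall x, cabs x = r -> cabs P.[x] <= B) -> cabs P`_i * r ^+ i <= B.
Proof.
move=> r0 PB; have [iP|Pi] := ltnP i (size P); last first.
  rewrite nth_default // cabs0 mul0r.
  have := PB r%:C (cabs_real (ltW r0)); apply: le_trans; exact: cabs_ge0.
set N := size P in iP; have N0 : (0 < N)%N by apply: leq_trans iP.
have [w wN] := complex_prim_root N0.
have w1 : cabs w = 1.
  have := congr1 cabs (prim_expr_order wN); rewrite cabsX cabs1 => /eqP.
  by rewrite pexpr_eq1 ?cabs_ge0 // => /eqP.
have w0 : w != 0 by rewrite -cabs_eq0 w1 oner_neq0.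
have e : \sum_(k < N) P.[r%:C * w ^+ k] * (w ^+ k) ^- i = N%:R * (P`_i * r%:C ^+ i).
  under eq_bigr => k _ do rewrite horner_coef big_distrl /=.
  rewrite exchange_big /= (bigD1 (Ordinal iP)) //= [X in _ + X]big1 ?addr0.
    rewrite (eq_bigr (fun=> P`_i * r%:C ^+ i)) ?sumr_const ?card_ord ?mulr_natl // => k _.
    by rewrite exprMn mulrA mulfK // !expf_neq0.
  move=> j /negbTE ji; pose z := w ^+ j / w ^+ i.
  have z1 : z - 1 != 0.
    rewrite subr_eq0 -(inj_eq (mulIf (expf_neq0 i w0))) divfK ?expf_neq0 // mul1r.
    by rewrite (eq_prim_root_expr wN) !modn_small //; apply/negbT; rewrite -ji.
  have zN : z ^+ N = 1.
    by rewrite exprMn exprVn -!exprM ![(_ * N)%N]mulnC !exprM (prim_expr_order wN)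
      !expr1n invr1 mulr1.
  rewrite (eq_bigr (fun k : 'I_N => P`_j * r%:C ^+ j * z ^+ k)); last first.
    move=> k _; rewrite /z !exprMn exprVn -!exprM [(i * k)%N]mulnC [(j * k)%N]mulnC; ring.
  rewrite -big_distrr /=; apply/eqP; rewrite mulf_eq0; apply/orP; right.
  by rewrite -(inj_eq (mulfI z1)) mulr0 -subrX1 zN subrr.
have N0R : 0 < N%:R :> R by rewrite ltr0n.
rewrite -(ler_pM2l N0R).
have -> : N%:R * (cabs P`_i * r ^+ i) = cabs (N%:R * (P`_i * r%:C ^+ i)).
  by rewrite !cabsM cabs_nat cabsX cabs_real // ltW.
rewrite -e; apply: le_trans (cabs_sum _ _ _) _.
apply: (@le_trans _ _ (\sum_(k < N) B)); last by rewrite sumr_const card_ord mulr_natl.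
apply: ler_sum => k _; rewrite cabsM cabsV !cabsX w1 !expr1n invr1 mulr1.
by apply: PB; rewrite cabsM cabsX w1 expr1n mulr1 cabs_real // ltW.
Qed.

Definition annulus (rho : R) (x : C) : Prop := rho^-1 <= cabs x <= rho.

(* Uniform limits of Laurent polynomials on every annulus: a substitute for
   Laurent series that is visibly closed under products. *)
Definition laurent_limit (g : C -> C) : Prop :=
  forall rho e : R, 1 <= rho -> 0 < e -> exists (d : nat) (P : {poly C}),
  forall x, annulus rho x -> cabs (g x - P.[x] / x ^+ d) <= e.

Lemma annulus_neq0 rho x : 1 <= rho -> annulus rho x -> x != 0.
Proof.
move=> r1 /andP[rx _]; rewrite -cabs_gt0; apply: lt_le_trans rx.
by rewrite invr_gt0 (lt_le_trans ltr01).
Qed.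

Lemma laurent_poly_bounded (P : {poly C}) d rho : 1 <= rho ->
  exists2 B : R, 0 <= B & forall x, annulus rho x -> cabs (P.[x] / x ^+ d) <= B.
Proof.
move=> r1; have r0 : 0 < rho := lt_le_trans ltr01 r1.
have S0 : 0 <= \sum_(i < size P) cabs P`_i * rho ^+ i.
  by apply: sumr_ge0 => i _; rewrite mulr_ge0 ?cabs_ge0 ?exprn_ge0 ?(ltW r0).
exists ((\sum_(i < size P) cabs P`_i * rho ^+ i) * rho ^+ d).
  by rewrite mulr_ge0 // exprn_ge0 // ltW.
move=> x xr; have x0 := annulus_neq0 r1 xr; case/andP: xr => x1 x2.
have X0 : 0 < cabs x by rewrite cabs_gt0.
rewrite cabsM; apply: ler_pM; rewrite ?cabs_ge0 //.
  rewrite horner_coef; apply: le_trans (cabs_sum _ _ _) _; apply: ler_sum => i _.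
  rewrite cabsM cabsX ler_wpM2l ?cabs_ge0 //.
  by apply: lerXn2r; rewrite ?nnegrE ?cabs_ge0 ?(ltW r0).
rewrite cabsV cabsX -exprVn; apply: lerXn2r; rewrite ?nnegrE ?invr_ge0 ?(ltW X0) ?(ltW r0) //.
by rewrite invf_ple // ?posrE.
Qed.

Lemma laurent_limit_bounded g rho : laurent_limit g -> 1 <= rho ->
  exists2 B : R, 0 <= B & forall x, annulus rho x -> cabs (g x) <= B.
Proof.
move=> gl r1; have [d [P gP]] := gl rho 1 r1 ltr01.
have [B B0 PB] := laurent_poly_bounded P d r1.
exists (1 + B) => [|x xr]; first by rewrite addr_ge0.
rewrite -[g x](subrK (P.[x] / x ^+ d)); apply: le_trans (cabsD _ _) _.
by apply: lerD; [exact: gP | exact: PB].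
Qed.

Lemma laurent_limit_eq g h : (forall x, x != 0 -> g x = h x) ->
  laurent_limit h -> laurent_limit g.
Proof.
move=> gh hl rho e r1 e0; have [d [P hP]] := hl rho e r1 e0; exists d, P => x xr.
by rewrite gh ?hP // (annulus_neq0 r1).
Qed.

Lemma laurent_limit_uniform g :
  (forall rho e : R, 1 <= rho -> 0 < e -> exists2 h, laurent_limit h &
    forall x, annulus rho x -> cabs (g x - h x) <= e) -> laurent_limit g.
Proof.
move=> gh rho e r1 e0; have e20 : 0 < e / 2 by rewrite divr_gt0.
have [h hl hg] := gh rho _ r1 e20; have [d [P hP]] := hl rho _ r1 e20.
exists d, P => x xr; rewrite (_ : _ - _ = (g x - h x) + (h x - P.[x] / x ^+ d)); last by ring.
by apply: le_trans (cabsD _ _) _; rewrite [leRHS]splitr lerD ?hg ?hP.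
Qed.

Lemma laurent_limit_cst c : laurent_limit (fun=> c).
Proof.
move=> rho e r1 e0; exists 0, c%:P => x _.
by rewrite hornerC expr0 divr1 subrr cabs0 ltW.
Qed.

Lemma laurent_limit_id : laurent_limit id.
Proof.
move=> rho e r1 e0; exists 0, 'X => x _.
by rewrite hornerX expr0 divr1 subrr cabs0 ltW.
Qed.

Lemma laurent_limitV : laurent_limit (fun x => x^-1).
Proof.
move=> rho e r1 e0; exists 1, 1%:P => x _.
by rewrite hornerC expr1 mul1r subrr cabs0 ltW.
Qed.

Lemma laurent_limitD g h : laurent_limit g -> laurent_limit h ->
  laurent_limit (fun x => g x + h x).
Proof.
move=> gl hl rho e r1 e0; have e20 : 0 < e / 2 by rewrite divr_gt0.
have [d [P gP]] := gl rho _ r1 e20; have [d' [P' hP]] := hl rho _ r1 e20.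
exists (d + d')%N, (P * 'X^d' + P' * 'X^d) => x xr.
have x0 := annulus_neq0 r1 xr.
rewrite !hornerE (_ : _ - _ = (g x - P.[x] / x ^+ d) + (h x - P'.[x] / x ^+ d')).
  by apply: le_trans (cabsD _ _) _; rewrite [leRHS]splitr lerD ?gP ?hP.
by rewrite exprD; field; rewrite !expf_neq0.
Qed.

Lemma laurent_limitM g h : laurent_limit g -> laurent_limit h ->
  laurent_limit (fun x => g x * h x).
Proof.
move=> gl hl rho e r1 e0.
have [Bg Bg0 gB] := laurent_limit_bounded gl r1.
have [Bh Bh0 hB] := laurent_limit_bounded hl r1.
(* The product error is [g * u + (h - u) * v] with [u], [v] at most [dl <= 1], hence at most
   [(Bg + Bh + 1) * dl]. *)
pose K := Bg + Bh + 1; have K0 : 0 < K by rewrite /K; lra.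
pose dl := Num.min 1 (e / K).
have dl0 : 0 < dl by rewrite lt_min ltr01 divr_gt0.
have dl1 : dl <= 1 by rewrite ge_min lexx.
have dlK : dl * K <= e by rewrite -ler_pdivlMr // ge_min lexx orbT.
have [d [P gP]] := gl rho _ r1 dl0; have [d' [P' hP]] := hl rho _ r1 dl0.
exists (d + d')%N, (P * P') => x xr; have x0 := annulus_neq0 r1 xr.
have a1 := gP x xr; have a2 := hP x xr; have a3 := gB x xr; have a4 := hB x xr.
rewrite hornerM (_ : _ - _ = g x * (h x - P'.[x] / x ^+ d') +
   (h x - (h x - P'.[x] / x ^+ d')) * (g x - P.[x] / x ^+ d)); last first.
  by rewrite exprD; field; rewrite !expf_neq0.
set u := h x - P'.[x] / x ^+ d' in a2 *; set v := g x - P.[x] / x ^+ d in a1 *.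
apply: le_trans (cabsD _ _) _; rewrite !cabsM.
have u0 := cabs_ge0 u; have v0 := cabs_ge0 v.
have g0 := cabs_ge0 (g x); have h0 := cabs_ge0 (h x).
have h1 : cabs (h x - u) <= Bh + 1 by apply: le_trans (cabsB _ _) _; lra.
have h2 := cabs_ge0 (h x - u).
apply: le_trans dlK; rewrite /K.
have e1 : cabs (g x) * cabs u <= Bg * dl by apply: ler_pM.
have e2 : cabs (h x - u) * cabs v <= (Bh + 1) * dl by apply: ler_pM.
by lra.
Qed.

Lemma laurent_limit_sum I (s : seq I) (Q : pred I) (g : I -> C -> C) :
  (forall i, Q i -> laurent_limit (g i)) ->
  laurent_limit (fun x => \sum_(i <- s | Q i) g i x).
Proof.
move=> gl; elim: s => [|i s IH].
  by under eq_fun do rewrite big_nil; exact: laurent_limit_cst.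
case Qi: (Q i); under eq_fun do rewrite big_cons Qi; last exact: IH.
by apply: laurent_limitD => //; exact: gl.
Qed.

Lemma laurent_limit_prod I (s : seq I) (Q : pred I) (g : I -> C -> C) :
  (forall i, Q i -> laurent_limit (g i)) ->
  laurent_limit (fun x => \prod_(i <- s | Q i) g i x).
Proof.
move=> gl; elim: s => [|i s IH].
  by under eq_fun do rewrite big_nil; exact: laurent_limit_cst.
case Qi: (Q i); under eq_fun do rewrite big_cons Qi; last exact: IH.
by apply: laurent_limitM => //; exact: gl.
Qed.

Lemma laurent_limitX g n : laurent_limit g -> laurent_limit (fun x => g x ^+ n).
Proof.
move=> gl; elim: n => [|n IH].
  by under eq_fun do rewrite expr0; exact: laurent_limit_cst.
by under eq_fun do rewrite exprS; exact: laurent_limitM.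
Qed.

Lemma laurent_limitZ c g : laurent_limit g -> laurent_limit (fun x => c * g x).
Proof. by apply: laurent_limitM; exact: laurent_limit_cst. Qed.

(* For an approximating Laurent polynomial with coefficients [P_i], the unit
   circle gives [|P_i| <= eps] and the boundary circles [|P_i| <= M rho^-|i-d|];
   the geometric mean of the two bounds is summable against [x^(i-d)]. *)
Lemma laurent_limit_eq0 g : laurent_limit g ->
  (forall x, cabs x = 1 -> g x = 0) -> forall x, x != 0 -> g x = 0.
Proof.
move=> gl g0 x x0; have X0 : 0 < cabs x by rewrite cabs_gt0.
pose y : R := cabs x + (cabs x)^-1.
have iX0 : 0 < (cabs x)^-1 by rewrite invr_gt0.
have xy : cabs x <= y by rewrite /y; lra.
have xy' : (cabs x)^-1 <= y by rewrite /y; lra.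
have y1 : 1 <= y.
  have [h|h] := lerP 1 (cabs x); first exact: le_trans h xy.
  by apply: le_trans xy'; rewrite invf_ge1 // ltW.
have y0 : 0 < y := lt_le_trans ltr01 y1.
(* The square root of [rho] is [2 * y]: [y] pays for the growth of [x ^ (i - d)] and 2 leaves a
   summable factor. *)
pose rho := (2 * y) ^+ 2.
have r1 : 1 <= rho by rewrite /rho exprn_ege1 //; lra.
have r0 : 0 < rho := lt_le_trans ltr01 r1.
have yr : y <= rho by rewrite /rho expr2; nra.
have xr : annulus rho x.
  rewrite /annulus (le_trans xy yr) andbT invf_ple ?posrE //.
  exact: le_trans xy' yr.
have ry : annulus rho 1 by rewrite /annulus cabs1 r1 andbT invf_le1.
have [M M0 gM] := laurent_limit_bounded gl r1.
apply/eqP; rewrite -cabs_eq0 eq_le cabs_ge0 andbT; apply/ler_addgt0Pr => e e0; rewrite add0r.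
(* The terms will be at most [dl * 2 ^ (- |i - d|)], with sum at most [4 * dl = e / 2]; [ep] is
   chosen so that [ep * M1 <= dl ^+ 2]. *)
pose dl := e / 8; have dl0 : 0 < dl by rewrite divr_gt0.
pose M1 := M + 1; have M10 : 0 < M1 by rewrite /M1; lra.
pose ep := Num.min (Num.min 1 (e / 2)) (dl ^+ 2 / M1).
have ep0 : 0 < ep by rewrite !lt_min ltr01 !divr_gt0 // exprn_gt0.
have ep1 : ep <= 1 by rewrite !ge_min lexx.
have ep2 : ep <= e / 2 by rewrite !ge_min lexx orbT.
have epM : ep * M1 <= dl ^+ 2 by rewrite -ler_pdivlMr // !ge_min lexx !orbT.
have [d [P gP]] := gl rho ep r1 ep0.
have bound1 i : cabs P`_i <= ep.
  have := @cauchy_estimate P 1 ep i ltr01; rewrite expr1n mulr1; apply=> z z1.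
  have /gP : annulus rho z by rewrite /annulus z1 r1 andbT invf_le1.
  by rewrite g0 // sub0r cabsN cabsM cabsV cabsX z1 expr1n invr1 mulr1.
have boundP z : annulus rho z -> cabs P.[z] <= M1 * cabs z ^+ d.
  move=> zr; have z0 := annulus_neq0 r1 zr.
  have -> : P.[z] = (g z - (g z - P.[z] / z ^+ d)) * z ^+ d by rewrite subKr divfK // expf_neq0.
  rewrite cabsM cabsX ler_wpM2r ?exprn_ge0 ?cabs_ge0 //.
  by apply: le_trans (cabsB _ _) _; apply: lerD; [exact: gM | exact: le_trans (gP _ zr) _].
have rn k : 0 < rho ^+ k by exact: exprn_gt0.
have bound2 i : cabs P`_i * rho ^+ i <= M1 * rho ^+ d.
  apply: cauchy_estimate => // z zr; rewrite -zr; apply: boundP.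
  by rewrite /annulus zr lexx andbT (le_trans _ r1) // invf_le1.
have bound3 i : cabs P`_i * rho ^+ d <= M1 * rho ^+ i.
  have Pr z : cabs z = rho^-1 -> cabs P.[z] <= M1 * rho^-1 ^+ d.
    move=> zr; rewrite -zr; apply: boundP.
    by rewrite /annulus zr lexx /= (le_trans _ r1) // invf_le1.
  have ir0 : 0 < rho^-1 by rewrite invr_gt0.
  have := cauchy_estimate i ir0 Pr; rewrite !exprVn => b.
  by rewrite -ler_pdivlMr ?rn // mulrAC -ler_pdivrMr ?rn.
pose h : R := 2^-1.
have half01 : 0 <= h < 1 by rewrite /h invr_ge0 ler0n invf_lt1 ?ltr1n ?ltr0n.
pose ad (i : nat) := ((i - d) + (d - i))%N.
have term i : cabs P`_i * cabs x ^+ i / cabs x ^+ d <= dl * h ^+ ad i.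
  have key : cabs P`_i * y ^+ ad i <= dl * h ^+ ad i.
    have k0 : 0 <= cabs P`_i * (2 * y) ^+ ad i.
      by rewrite mulr_ge0 ?cabs_ge0 ?exprn_ge0 ?mulr_ge0 ?ltW.
    suff : cabs P`_i * (2 * y) ^+ ad i <= dl.
      move=> hk; rewrite /h exprVn ler_pdivlMr ?exprn_gt0 //.
      by rewrite -mulrA [y ^+ _ * _]mulrC -exprMn.
    rewrite -ler_sqr ?nnegrE ?(ltW dl0) //; apply: le_trans epM.
    rewrite exprMn -exprM mulnC exprM -/rho expr2 -mulrA.
    apply: ler_pM (cabs_ge0 _) (mulr_ge0 (cabs_ge0 _) (ltW (rn _))) (bound1 i) _.
    have [di|id] := leqP d i.
      have := bound2 i; rewrite -[in rho ^+ i](subnK di) exprD mulrA ler_pM2r ?rn //.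
      by have -> : ad i = (i - d)%N by exact: dist_geq.
    have := bound3 i; rewrite -[in rho ^+ d](subnK (ltnW id)) exprD mulrA ler_pM2r ?rn //.
    by have -> : ad i = (d - i)%N by rewrite /ad addnC; exact: dist_geq (ltnW id).
  apply: le_trans key; rewrite -mulrA ler_wpM2l ?cabs_ge0 //.
  have [di|id] := leqP d i.
    have -> : ad i = (i - d)%N by exact: dist_geq.
    rewrite -[in cabs x ^+ i](subnK di) exprD mulfK ?expf_neq0 ?gt_eqF //.
    by apply: lerXn2r; rewrite ?nnegrE ?cabs_ge0 ?(ltW y0).
  have -> : ad i = (d - i)%N by rewrite /ad addnC; exact: dist_geq (ltnW id).
  rewrite -[in cabs x ^+ d](subnK (ltnW id))
    exprD invfM mulrCA mulfV ?mulr1 ?expf_neq0 ?gt_eqF // -exprVn.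
  by apply: lerXn2r; rewrite ?nnegrE ?(ltW iX0) ?(ltW y0).
have geo n : \sum_(i < n) h ^+ i <= 2.
  have := geometric_sum_le 0 n half01; rewrite big_mkord expr0 mul1r.
  by rewrite (_ : (1 - h)^-1 = 2) // /h; field.
have sum_h n : \sum_(i < n) h ^+ ad i <= 4.
  apply: (@le_trans _ _ (\sum_(i < d + n) h ^+ ad i)).
    rewrite addnC big_split_ord /= lerDl sumr_ge0 // => i _.
    by rewrite exprn_ge0 //; case/andP: half01.
  rewrite big_split_ord /= (_ : 4 = 2 + 2); last by ring.
  apply: lerD; last first.
    rewrite (eq_bigr (fun i : 'I_n => h ^+ i)) ?geo // => i _.
    by congr (_ ^+ _); rewrite /ad dist_geq ?leq_addr // addKn.
  rewrite (reindex_inj rev_ord_inj) /=; apply: le_trans (geo d); apply: ler_sum => i _.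
  have [h0 /ltW h1] := andP half01; apply: ler_wiXn2l => //.
  rewrite /ad addnC dist_geq; last by rewrite leq_subr.
  by rewrite subKn.
have px : cabs (P.[x] / x ^+ d) <= e / 2.
  rewrite cabsM cabsV cabsX horner_coef; apply: (@le_trans _ _ (\sum_(i < size P) dl * h ^+ ad i)).
    rewrite ler_pdivrMr ?exprn_gt0 // big_distrl; apply: le_trans (cabs_sum _ _ _) _.
    apply: ler_sum => i _ /=; rewrite -ler_pdivrMr ?exprn_gt0 // cabsM cabsX; exact: term.
  rewrite -big_distrr /=; apply: (@le_trans _ _ (dl * 4)).
    by apply: ler_wpM2l; [exact: ltW | exact: sum_h].
  by rewrite /dl; lra.
rewrite -[g x](subrK (P.[x] / x ^+ d)); apply: le_trans (cabsD _ _) _.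
by have := gP x xr; lra.
Qed.

End LaurentLimits.

(** * Extending the vanishing from the unit torus *)

Section Continuation.
Context {R : realType} (q : R[i]) (q_neq0 : q != 0) (q_lt1 : cabs q < 1).
Local Notation C := R[i].

(** The triple product concerns the empty set of insertions, so it is applied with an empty index
    type, where the conditions on the [s i] are vacuous. *)
Lemma thetasD_series : exists K : C, forall k x, x != 0 ->
  thetasD q k x = K * theta_series q k x.
Proof.
pose s (i : 'I_0) : C := 1.
exists ((qpoch q q)^-2 * corr_lim q s finset.set0) => k.
apply: (thetasD_theta_series q_lt1) => x x0.
by apply: jacobi_triple => // -[].
Qed.

Lemma laurent_theta_half k g : laurent_limit g ->
  laurent_limit (fun x => theta_half q k (g x)).
Proof.
move=> gl; apply: laurent_limit_uniform => rho e r1 e0.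
have [B B0 gB] := laurent_limit_bounded gl r1.
have [K K0 hK] := theta_half_approx q_lt1 k B0.
have half01 : 0 <= (2^-1 : R) < 1 by rewrite invr_ge0 ler0n invf_lt1 ?ltr1n ?ltr0n.
have [N hN] := geometric_small K half01 e0.
exists (fun x => theta_half_part q k (g x) N).
  by apply: laurent_limit_sum => j _; apply/laurent_limitZ/laurent_limitX.
move=> x /gB xB; rewrite cabs_distC; apply: le_trans (hK N _ xB) _.
exact: ltW (hN N (leqnn N)).
Qed.

(** A theta series involves its argument and the inverse of it, so both must be admissible. *)
Definition laurent_unit (g : C -> C) : Prop :=
  [/\ forall x, x != 0 -> g x != 0, laurent_limit g & laurent_limit (fun x => (g x)^-1)].

Lemma laurent_unit_cst c : c != 0 -> laurent_unit (fun=> c).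
Proof. by move=> c0; split=> //; exact: laurent_limit_cst. Qed.

Lemma laurent_unit_id : laurent_unit id.
Proof. by split=> //; [exact: laurent_limit_id | exact: laurent_limitV]. Qed.

Lemma laurent_unitV g : laurent_unit g -> laurent_unit (fun x => (g x)^-1).
Proof.
move=> [g0 gl gVl]; split=> // [x x0|]; first by rewrite invr_eq0 g0.
by under eq_fun do rewrite invrK.
Qed.

Lemma laurent_unitM g h : laurent_unit g -> laurent_unit h ->
  laurent_unit (fun x => g x * h x).
Proof.
move=> [g0 gl gVl] [h0 hl hVl]; split=> [x x0||]; first by rewrite mulf_neq0 ?g0 ?h0.
  exact: laurent_limitM.
by under eq_fun do rewrite invfM; exact: laurent_limitM.
Qed.

Lemma laurent_unit_prod I (s : seq I) (Q : pred I) (g : I -> C -> C) :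
  (forall i, laurent_unit (g i)) -> laurent_unit (fun x => \prod_(i <- s | Q i) g i x).
Proof.
move=> gl; elim: s => [|i s IH].
  by under eq_fun do rewrite big_nil; apply: laurent_unit_cst; exact: oner_neq0.
case Qi: (Q i); under eq_fun do rewrite big_cons Qi; last exact: IH.
by apply: laurent_unitM.
Qed.

Lemma laurent_thetasD k g : laurent_unit g -> laurent_limit (fun x => thetasD q k (g x)).
Proof.
move=> [g0 gl gVl]; have [K hK] := thetasD_series.
apply: (@laurent_limit_eq _ _ (fun x => K * (theta_half q k (g x) +
    - (-1) ^+ k * theta_half q k (g x)^-1))).
  by move=> x x0; rewrite hK ?g0 // /theta_series mulNr.
by apply: laurent_limitZ; apply: laurent_limitD; last apply: laurent_limitZ;
  apply: laurent_theta_half.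
Qed.

Lemma laurent_det n (M : C -> 'M[C]_n) :
  (forall i j, laurent_limit (fun x => M x i j)) -> laurent_limit (fun x => \det (M x)).
Proof.
move=> Ml; apply: laurent_limit_sum => sigma _; apply: laurent_limitZ.
by apply: laurent_limit_prod => i _; exact: Ml.
Qed.

(** The products inside the sum clear the denominators. The extra product in front makes the
    function zero wherever some denominator vanishes, so it vanishes on the whole torus and not only
    at generic points. *)
Definition cleared_T n (s : 'I_n -> C) : C :=
  (\prod_(sigma : 'S_n) Tden q s sigma) *
  \sum_(sigma : 'S_n) \det (Tmat q s sigma) *
    \prod_(tau : 'S_n | tau != sigma) Tden q s tau.

Lemma cleared_TE n (s : 'I_n -> C) :
  (forall sigma, Tden q s sigma != 0) ->
  cleared_T s = (\prod_(sigma : 'S_n) Tden q s sigma) ^+ 2 * Tfun q s.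
Proof.
move=> d0; rewrite /cleared_T expr2 -mulrA; congr (_ * _).
rewrite /Tfun big_distrr; apply: eq_bigr => sigma _ /=.
by rewrite [in RHS](bigD1 sigma) //= [RHS]mulrC mulrA divfK ?d0.
Qed.

Lemma laurent_cleared_T n (s : C -> 'I_n -> C) :
  (forall i, laurent_unit (fun x => s x i)) -> laurent_limit (fun x => cleared_T (s x)).
Proof.
move=> sl; have pl sigma k : laurent_unit (fun x => sprefix (s x) sigma k).
  by apply: laurent_unit_prod => i; exact: sl.
have dl sigma : laurent_limit (fun x => Tden q (s x) sigma).
  by apply: laurent_limit_prod => k _; apply: (laurent_thetasD 0); exact: pl.
apply: laurent_limitM; first by apply: laurent_limit_prod => sigma _; exact: dl.
apply: laurent_limit_sum => sigma _; apply: laurent_limitM.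
  apply: laurent_det => i j.
  case ij: (i <= j.+1)%N; under eq_fun do rewrite mxE ij; last exact: laurent_limit_cst.
  apply: laurent_limitM; last exact: laurent_limit_cst.
  by apply: laurent_thetasD; exact: pl.
by apply: laurent_limit_prod => tau _; exact: dl.
Qed.

Lemma thetas_sqr1 (x : C) : x ^+ 2 = 1 -> thetas q x = 0.
Proof.
move=> x2; have x0 : x != 0 by apply: contra_eq_neq x2 => ->; rewrite expr0n eq_sym oner_neq0.
by rewrite /thetas (_ : x^-1 = x) ?subrr ?mulr0 ?mul0r //; apply: (mulfI x0); rewrite mulfV.
Qed.

Lemma cleared_T_torus n (s : 'I_n -> C) : (2 <= n)%N ->
  (forall i, cabs (s i) = 1) -> (\prod_i s i) ^+ 2 = 1 -> cleared_T s = 0.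
Proof.
move=> n2 s1 sT.
have [/existsP[sigma /eqP d0]|] := boolP [exists sigma : 'S_n, Tden q s sigma == 0].
  by rewrite /cleared_T (bigD1 sigma) //= d0 !mul0r.
rewrite negb_exists => /forallP d0; rewrite cleared_TE // (_ : Tfun q s = 0) ?mulr0 //.
have th0 sigma k : (0 < k < n)%N -> thetas q (sprefix s sigma k) != 0.
  move=> kn; have := d0 sigma; rewrite /Tden big_nat.
  by rewrite prodf_seq_neq0 => /allP/(_ k); rewrite mem_index_iota kn => /(_ isT).
(* As [n >= 2], each [s i] is itself a prefix of length one, so its theta is nonzero. *)
have s2 i : s i ^+ 2 != 1.
  apply/negP => /eqP/thetas_sqr1 si.
  have n0 : (0 < n)%N by apply: ltn_trans n2.
  have /eqP := th0 (tperm (Ordinal n0) i) 1%N n2; apply; rewrite -[RHS]si; congr thetas.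
  rewrite /sprefix (big_pred1 (Ordinal n0)) ?tpermL // => j /=.
  by rewrite ltnS leqn0 -val_eqE.
have x1 : sprefix s 1 1 != 0.
  by apply/prodf_neq0 => i _; rewrite -cabs_eq0 s1 oner_neq0.
have [K hK] := thetasD_series.
(* By the triple product, a zero here would make Theta vanish at a prefix. *)
have Y0 : corr_lim q s finset.set0 != 0.
  have := th0 1%g 1%N n2; apply: contraNneq => Y0.
  by rewrite (jacobi_triple q_neq0 q_lt1 s1 s2 x1) Y0 mulr0 mul0r.
have sp0 S : sprod s S != 0 by apply/prodf_neq0 => i _; rewrite -cabs_eq0 s1 oner_neq0.
apply: (@sum_det_prefix_mx _ n (thetasD q) s (fun S => sprod s S * corr_lim q s S)).
- exact: ltn_trans n2.
- move=> S; have e := corr_lim_relation q_neq0 q_lt1 s1 s2 S.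
  rewrite -[RHS](mulr0 K) -[X in K * X]e mulr_sumr; apply: eq_bigr => B _.
  by rewrite -/(sprod s B) (hK _ _ (sp0 B)); ring.
- exact: th0.
- by rewrite mulf_neq0.
exact: thetas_sqr1.
Qed.

(* The moduli of [s 0, s 1, ...] are moved off the unit circle one at a time,
   the last coordinate absorbing the change. *)
Lemma cleared_T_eq0 n (s : 'I_n -> C) : (2 <= n)%N ->
  (forall i, s i != 0) -> (\prod_i s i) ^+ 2 = 1 -> cleared_T s = 0.
Proof.
case: n s => [//|n] s n2.
suff H j : (j <= n)%N -> forall s : 'I_n.+1 -> C, (forall i, s i != 0) ->
    (\prod_i s i) ^+ 2 = 1 -> (forall i : 'I_n.+1, (j <= i < n)%N -> cabs (s i) = 1) ->
    cleared_T s = 0.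
  by move=> s0 sT; apply: (H n) => // i; case: ltngtP.
elim: j => [|j IH] jn {}s s0 sT s1.
  (* Once the other moduli are 1, the product condition forces the last one. *)
  apply: cleared_T_torus => // i; have [iN|iN] := ltnP i n; first exact: s1.
  have -> : i = ord_max by apply/val_inj/eqP; rewrite eqn_leq iN -ltnS ltn_ord.
  have := congr1 cabs sT; rewrite cabsX cabs_prod big_ord_recr /= big1 ?mul1r.
    by rewrite cabs1 => /eqP; rewrite sqrp_eq1 ?cabs_ge0 // => /eqP.
  by move=> l _; apply: s1 => /=.
pose jo : 'I_n.+1 := Ordinal (leq_trans jn (leqnSn n)).
pose r : C := (cabs (s jo))%:C.
have R0 : 0 < cabs (s jo) by rewrite cabs_gt0.
have r0 : r != 0 by rewrite -cabs_eq0 cabs_real ?gt_eqF // ltW.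
(* A curve inside the hypersurface: [x = r] gives back [s], while [cabs x = 1] puts coordinate [jo]
   on the unit circle. *)
pose sx (x : C) (i : 'I_n.+1) : C :=
  if i == jo then s jo / r * x else if i == ord_max then s ord_max * r / x else s i.
have jm : jo != ord_max by rewrite -val_eqE /= ltn_eqF.
have sxr : sx r = s.
  apply/funext => i; rewrite /sx; case: eqP => [->|_]; first by rewrite divfK.
  by case: eqP => [->|//]; rewrite mulfK.
have sx0 x i : x != 0 -> sx x i != 0.
  by move=> x0; rewrite /sx; case: ifP => _; [|case: ifP => _];
    rewrite ?mulf_neq0 ?invr_eq0.
have sxT x : x != 0 -> \prod_i sx x i = \prod_i s i.
  move=> x0; rewrite (bigD1 jo) //= (bigD1 ord_max) 1?eq_sym //=.
  rewrite [RHS](bigD1 jo) //= [X in _ = _ * X](bigD1 ord_max) 1?eq_sym //=.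
  rewrite /sx eqxx eq_sym (negbTE jm) eqxx mulrA [RHS]mulrA; congr (_ * _).
    by field; rewrite x0 r0.
  by apply: eq_bigr => i /andP[/negbTE -> /negbTE ->].
rewrite -sxr.
apply: (@laurent_limit_eq0 _ (fun x => cleared_T (sx x)) _ _ _ r0) => [|x x1].
  apply: laurent_cleared_T => i; rewrite /sx.
  case: (i == jo).
    apply: laurent_unitM laurent_unit_id; apply: laurent_unit_cst.
    by rewrite mulf_neq0 ?invr_neq0.
  case: (i == ord_max); last exact: laurent_unit_cst.
  apply: laurent_unitM; last exact: laurent_unitV laurent_unit_id.
  by apply: laurent_unit_cst; rewrite mulf_neq0.
have x0 : x != 0 by rewrite -cabs_eq0 x1 oner_neq0.
apply: IH => [|i||i /andP[ji iN]]; rewrite ?sx0 ?sxT //; first exact: ltnW.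
rewrite /sx; have [_|ij] := eqVneq i jo.
  by rewrite !cabsM cabsV cabs_real ?(ltW R0) // x1 mulr1 mulfV // gt_eqF.
have im : i != ord_max by rewrite -val_eqE /= ltn_eqF.
rewrite (negbTE im); apply: s1; rewrite iN andbT ltn_neqAle ji andbT.
by rewrite eq_sym; move: ij; rewrite -val_eqE.
Qed.

End Continuation.

Theorem theorem11p2 (R : realType) (q : (R[i])^o) (hq0 : 0 < `|q|) (hq1 : `|q| < 1)
  (n : nat) (hn : (2 <= n)%N) (s : 'I_n -> (R[i])^o)
  (hs : forall i, s i != 0)
  (hprod : (\prod_(i < n) s i) ^+ 2 = 1)
  (hgen : forall (sigma : 'S_n) (k : nat), (1 <= k < n)%N ->
            thetas q (sprefix s sigma k) != 0) :
  Tfun q s = 0.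
Proof.
have q0 : (q : R[i]) != 0 by rewrite -normr_gt0.
have q1 : cabs q < 1 by move: hq1; rewrite -[`|q|]/((cabs q)%:C) ltcR.
have d0 sigma : Tden q s sigma != 0.
  rewrite /Tden big_nat prodf_seq_neq0; apply/allP => k _; apply/implyP => kn.
  exact: hgen.
have := cleared_T_eq0 q0 q1 hn hs hprod; rewrite cleared_TE // => /eqP.
rewrite mulf_eq0 expf_eq0 /= prodf_seq_eq0 => /orP[/hasP[sigma _]|/eqP //].
by rewrite (negbTE (d0 sigma)).
Qed.
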